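(* Let $\mathbf R=\{R_i,t_i\}_{i\ge0}$ be a preperfectoid tower arising from a pair $(R,I_0)$, and let $R\to S$ be a weakly étale ring homomorphism. Put $S_i:=R_i\otimes_RS$. (1) The tower $\mathbf R\otimes_RS=\{S_i,\ t_i\otimes_RS\}_{i\ge0}$ is a preperfectoid tower arising from $(S,I_0S)$. (2) For every $i\ge0$, the $i$-th perfectoid pillar of $\mathbf R\otimes_RS$ is $I_iS_i$, where $I_i\subset R_i$ is the $i$-th perfectoid pillar of $\mathbf R$. Moreover, the small tilt of $I_iS_i$ is $I_i^{s.\flat}S_i^{s.\flat}$, where $S_i^{s.\flat}$ is the $i$-th small tilt of $\mathbf R\otimes_RS$, $I_i^{s.\flat}\subset R_i^{s.\flat}$ is the small tilt of $I_i$, and $I_i^{s.\flat}S_i^{s.\flat}$ is its extension along the $i$-th component $R_i^{s.\flat}\to S_i^{s.\flat}$ of the tilt of the canonical morphism $\mathbf R\to\mathbf R\otimes_RS$.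
   Context: Fix a prime $p$; rings are commutative with $1$. A ring map $A\to B$ is weakly étale if it is flat and $B\otimes_AB\to B$ is flat. For a ring $A$, an ideal $I$ and an $A$-module $M$, $M_{I\text{-tor}}$ is the submodule of $x\in M$ such that for every $a\in I$ some $a^nx=0$; $\varphi_{I,A}\colon A_{I\text{-tor}}\to A/IA$ is inclusion followed by projection. $\varphi$ is absolute Frobenius. A tower of rings $\{R_i,t_i\}_{i\ge0}$ is a sequence of ring maps $R_0\xrightarrow{t_0}R_1\to\cdots$. For a ring $R$ and ideal $I_0$, write $\overline{R_i}=R_i/I_0R_i$, $\overline{t_i}$ the induced maps. A purely inseparable tower arising from $(R,I_0)$: (a) $R_0=R$, $p\in I_0$; (b) each $\overline{t_i}$ injective; (c) $\varphi(\overline{R_{i+1}})\subset\overline{t_i}(\overline{R_i})$; then $F_i\colon\overline{R_{i+1}}\to\overline{R_i}$ is the unique ring map with $\overline{t_i}\circ F_i=\varphi$. A preperfectoid tower is a purely inseparable tower with: (d) each $F_i$ surjective; (f) $I_0$ principal and a principal ideal $I_1\subset R_1$ (first perfectoid pillar) with $I_1^p=I_0R_1$ and $\ker F_i=I_1\overline{R_{i+1}}$ for all $i$; (g) for all $i$, $I_0(R_i)_{I_0\text{-tor}}=0$ and a bijection $(F_i)_{\mathrm{tor}}\colon(R_{i+1})_{I_0\text{-tor}}\to(R_i)_{I_0\text{-tor}}$ with $\varphi_{I_0,R_i}\circ(F_i)_{\mathrm{tor}}=F_i\circ\varphi_{I_0,R_{i+1}}$. Perfectoid pillars: for a preperfectoid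 tower there is a unique sequence of finitely generated ideals $I_i\subset R_i$ ($i\ge2$) with $I_0R_i\subset I_i$ such that $F_i(I_{i+1}\overline{R_{i+1}})=I_i\overline{R_i}$ for all $i\ge0$; $I_i$ is the $i$-th perfectoid pillar ($I_0$, $I_1$ as given). Tilt: $R_i^{s.\flat}:=\varprojlim(\cdots\xrightarrow{F_{i+1}}\overline{R_{i+1}}\xrightarrow{F_i}\overline{R_i})$ with $0$-th projection $\Phi^{(i)}_0\colon R_i^{s.\flat}\to\overline{R_i}$; the small tilt of $I_i$ is $I_i^{s.\flat}:=\ker(R_i^{s.\flat}\xrightarrow{\Phi^{(i)}_0}\overline{R_i}\to R_i/I_iR_i)$. For a morphism of preperfectoid towers $\alpha\colon\mathbf R\to\mathbf S$ with $\alpha_0(I_0)\subset J_0$, the induced maps $\overline{R_j}\to\overline{S_j}$ are compatible with Frobenius projections and induce $\alpha_i^{s.\flat}\colon R_i^{s.\flat}\to S_i^{s.\flat}$. *)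

(* Defs.v *)
From HB Require Import structures.
From mathcomp Require Import all_boot all_order all_algebra.
Set Implicit Arguments. Unset Strict Implicit. Unset Printing Implicit Defensive.
Import GRing.Theory.
Local Open Scope ring_scope.

Definition same_set (T : Type) (P Q : T -> Prop) := forall x, P x <-> Q x.

Definition ext (A B : comPzRingType) (f : A -> B) (I : A -> Prop) : B -> Prop :=
  fun x => exists n (a : 'I_n -> A) (r : 'I_n -> B),
    (forall k, I (a k)) /\ x = \sum_(k < n) f (a k) * r k.

Definition gen_by (A : comPzRingType) n (g : 'I_n -> A) : A -> Prop :=
  fun x => exists r : 'I_n -> A, x = \sum_(k < n) r k * g k.

Definition fin_gen (A : comPzRingType) (I : A -> Prop) :=
  exists n (g : 'I_n -> A), same_set I (gen_by g).

Definition principal (A : comPzRingType) (I : A -> Prop) :=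
  exists g : A, same_set I (fun x => exists r, x = r * g).

Definition ideal_pow (A : comPzRingType) (I : A -> Prop) (n : nat) : A -> Prop :=
  ext id (fun x => exists s : 'I_n -> A, (forall k, I (s k)) /\ x = \prod_(k < n) s k).

Definition idl_add (A : comPzRingType) (I J : A -> Prop) : A -> Prop :=
  fun z => exists a b, I a /\ J b /\ z = a + b.

Definition additive_fun (M N : zmodType) (h : M -> N) :=
  forall x y, h (x + y) = h x + h y.

Definition biadditive (M N Z : zmodType) (g : M -> N -> Z) :=
  (forall m x y, g m (x + y) = g m x + g m y) /\
  (forall m m' x, g (m + m') x = g m x + g m' x).

Definition balanced (A B : comPzRingType) (f : A -> B) (M : lmodType A)
  (Z : zmodType) (g : M -> B -> Z) :=
  forall a m b, g (a *: m) b = g m (f a * b).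

Definition is_tensor (A B : comPzRingType) (f : A -> B) (M : lmodType A)
  (T : zmodType) (beta : M -> B -> T) :=
  biadditive beta /\ balanced f beta /\
  forall (Z : zmodType) (g : M -> B -> Z), biadditive g -> balanced f g ->
    (exists h : T -> Z, additive_fun h /\ forall m b, h (beta m b) = g m b) /\
    (forall h h' : T -> Z, additive_fun h -> additive_fun h' ->
       (forall m b, h (beta m b) = g m b) -> (forall m b, h' (beta m b) = g m b) ->
       forall x, h x = h' x).

Definition flat (A B : comPzRingType) (f : A -> B) :=
  forall (M N : lmodType A) (u : M -> N),
    (forall a x y, u (a *: x + y) = a *: u x + u y) -> injective u ->
    forall (TM TN : zmodType) (bM : M -> B -> TM) (bN : N -> B -> TN),
      is_tensor f bM -> is_tensor f bN ->
      forall h : TM -> TN, additive_fun h ->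
        (forall m b, h (bM m b) = bN (u m) b) -> injective h.

Definition is_pushout (A B C P : comPzRingType) (f : A -> B) (g : A -> C)
  (i1 : B -> P) (i2 : C -> P) :=
  (forall a, i1 (f a) = i2 (g a)) /\
  forall (T : comPzRingType) (h1 : {rmorphism B -> T}) (h2 : {rmorphism C -> T}),
    (forall a, h1 (f a) = h2 (g a)) ->
    (exists h : {rmorphism P -> T}, (forall b, h (i1 b) = h1 b) /\ (forall c, h (i2 c) = h2 c)) /\
    (forall h h' : {rmorphism P -> T},
       (forall b, h (i1 b) = h1 b) -> (forall c, h (i2 c) = h2 c) ->
       (forall b, h' (i1 b) = h1 b) -> (forall c, h' (i2 c) = h2 c) ->
       forall x, h x = h' x).

Definition weakly_etale (A B : comPzRingType) (f : {rmorphism A -> B}) :=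
  flat (f : A -> B) /\
  forall (P : comPzRingType) (i1 i2 : {rmorphism B -> P}),
    is_pushout (f : A -> B) (f : A -> B) (i1 : B -> P) (i2 : B -> P) ->
    forall mu : {rmorphism P -> B},
      (forall b, mu (i1 b) = b) -> (forall b, mu (i2 b) = b) -> flat (mu : P -> B).

Fixpoint tw (R : nat -> comPzRingType) (t : forall i, {rmorphism R i -> R i.+1})
  (i : nat) : R 0%N -> R i :=
  match i as n return R 0%N -> R n with
  | 0 => fun x => x
  | j.+1 => fun x => t j (tw t j x)
  end.

Fixpoint tw1 (R : nat -> comPzRingType) (t : forall i, {rmorphism R i -> R i.+1})
  (i : nat) : R 1%N -> R i.+1 :=
  match i as n return R 1%N -> R n.+1 with
  | 0 => fun x => x
  | j.+1 => fun x => t j.+1 (tw1 t j x)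
  end.

Definition I0R (R : nat -> comPzRingType) (t : forall i, {rmorphism R i -> R i.+1})
  (I0 : R 0%N -> Prop) (i : nat) : R i -> Prop := ext (tw t i) I0.
Arguments I0R {R} t I0 i _.

Definition I1R (R : nat -> comPzRingType) (t : forall i, {rmorphism R i -> R i.+1})
  (I1 : R 1%N -> Prop) (i : nat) : R i.+1 -> Prop := ext (tw1 t i) I1.
Arguments I1R {R} t I1 i _.

(* Frel: F_i (class of y) = class of x, i.e. y^p = t_i(x) mod I_0 R_{i+1} *)
Definition Frel (p : nat) (R : nat -> comPzRingType) (t : forall i, {rmorphism R i -> R i.+1})
  (I0 : R 0%N -> Prop) (i : nat) (y : R i.+1) (x : R i) : Prop :=
  I0R t I0 i.+1 (y ^+ p - t i x).
Arguments Frel p {R} t I0 i y x.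

Definition tor (R : nat -> comPzRingType) (t : forall i, {rmorphism R i -> R i.+1})
  (I0 : R 0%N -> Prop) (i : nat) (x : R i) : Prop :=
  forall a, I0 a -> exists n, (tw t i a) ^+ n * x = 0.

Definition purely_inseparable (p : nat) (R : nat -> comPzRingType)
  (t : forall i, {rmorphism R i -> R i.+1}) (I0 : R 0%N -> Prop) :=
  I0 (p%:R) /\
  (forall i (x : R i), I0R t I0 i.+1 (t i x) -> I0R t I0 i x) /\
  (forall i (y : R i.+1), exists x : R i, Frel p t I0 i y x).

Definition preperfectoid (p : nat) (R : nat -> comPzRingType)
  (t : forall i, {rmorphism R i -> R i.+1}) (I0 : R 0%N -> Prop) (I1 : R 1%N -> Prop) :=
  purely_inseparable p t I0 /\
  (forall i (x : R i), exists y : R i.+1, Frel p t I0 i y x) /\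
  principal I0 /\ principal I1 /\ same_set (ideal_pow I1 p) (I0R t I0 1%N) /\
  (forall i (y : R i.+1),
     I0R t I0 i.+1 (y ^+ p) <-> idl_add (I1R t I1 i) (I0R t I0 i.+1) y) /\
  (forall i,
     (forall (a : R 0%N) (x : R i), I0 a -> tor t I0 x -> tw t i a * x = 0) /\
     exists G : R i.+1 -> R i,
       (forall y, tor t I0 y -> tor t I0 (G y)) /\
       (forall y y', tor t I0 y -> tor t I0 y' -> G y = G y' -> y = y') /\
       (forall x, tor t I0 x -> exists y, tor t I0 y /\ G y = x) /\
       (forall y, tor t I0 y -> Frel p t I0 i y (G y))).

Definition pillars (p : nat) (R : nat -> comPzRingType)
  (t : forall i, {rmorphism R i -> R i.+1}) (I0 : R 0%N -> Prop) (I1 : R 1%N -> Prop)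
  (J : forall i, R i -> Prop) :=
  same_set (J 0%N) I0 /\ same_set (J 1%N) I1 /\
  (forall i, (2 <= i)%N -> fin_gen (J i) /\ (forall x, I0R t I0 i x -> J i x)) /\
  (* F_i (J_{i+1} Rbar_{i+1}) = J_i Rbar_i *)
  (forall i (y : R i.+1), idl_add (J i.+1) (I0R t I0 i.+1) y ->
     exists x, idl_add (J i) (I0R t I0 i) x /\ Frel p t I0 i y x) /\
  (forall i (x : R i), idl_add (J i) (I0R t I0 i) x ->
     exists y, idl_add (J i.+1) (I0R t I0 i.+1) y /\ Frel p t I0 i y x).

(* elements of the tilt R_i^{s.flat}: Frobenius-compatible sequences of
   representatives x_j in R_{i+j} (taken modulo I_0 R_{i+j}) *)
Definition tilt (p : nat) (R : nat -> comPzRingType)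
  (t : forall i, {rmorphism R i -> R i.+1}) (I0 : R 0%N -> Prop) (i : nat)
  (x : forall j, R (j + i)) : Prop :=
  forall j, Frel p t I0 (j + i) (x j.+1) (x j).

Definition stilt (p : nat) (R : nat -> comPzRingType)
  (t : forall i, {rmorphism R i -> R i.+1}) (I0 : R 0%N -> Prop) (i : nat)
  (J : R i -> Prop) (x : forall j, R (j + i)) : Prop :=
  tilt p t I0 x /\ idl_add J (I0R t I0 i) (x 0%N).

(* Main.v *)
Require Import Defs.
From HB Require Import structures.
From mathcomp Require Import all_boot all_order all_algebra.
From mathcomp Require Import boolp ring.
Import GRing.Theory.
Local Open Scope ring_scope.
Local Open Scope quotient_scope.
Set Implicit Arguments. Unset Strict Implicit. Unset Printing Implicit Defensive.

(* Write A for R modulo I_0, B for S modulo I_0 S, and phi for the map A -> B.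
   Flatness enters only through its equational criterion ([flat_relations]): a relation
   sum m_k (x) b_k = 0 comes from b_k = sum_j c_kj b'_j with sum_k c_kj m_k = 0.  It makes
   injectivity of t_i, the I_0-torsion and intersections of ideals commute with - (x)_R S.
   Flatness of the diagonal says that every x in ker (B (x)_A B -> B) is killed by some c mapping
   to 1.  This makes the relative Frobenius a (x) b |-> phi(a) b^p bijective.
   Surjectivity: let c = sum u_l (x) v_l kill b (x) 1 - 1 (x) b.  So does
   c^p = sum u_l^p (x) v_l^p, and the criterion gives C_j, D_j in A[B^p] and w_j in B with
   b D_j = C_j and sum D_j w_j = 1, whence b = sum C_j D_j^(p-1) w_j^p.
   Injectivity: if x = sum a_k (x) b_k goes to 0, let c kill all b_k (x) 1 - 1 (x) b_k; the
   criterion applied to sum_l x (1 (x) u_l) (x) v_l^p = 0 gives C_j with x C_j = 0 and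
   sum C_j^p (1 (x) w_j) = 1, whence x = 0.
   Surjectivity lifts elements along the Frobenius projections of the new tower; injectivity
   computes their kernels.
   For the tilts, choose f_0, f_1 generating I_0, I_1 and f_(j+1) over f_j: modulo I_0 the
   pillar I_j is (f_j), and dividing a sequence (y_j) by (f_(i+j)) term by term is consistent up to
   I_0-torsion, which the bijections (F_i)_tor allow to correct.  Hence the small tilt of I_i is
   principal, generated by (f_(i+j))_j, both for R and for S. *)

(** * Tensor products as quotients of words *)

Section Biadditive.
Variables (M N Z : zmodType) (g : M -> N -> Z).
Hypothesis gP : biadditive g.

Lemma biadd0l x : g 0 x = 0.
Proof. by apply: (@addrI _ (g 0 x)); rewrite -gP.2 !addr0. Qed.
Lemma biadd0r m : g m 0 = 0.
Proof. by apply: (@addrI _ (g m 0)); rewrite -gP.1 !addr0. Qed.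
Lemma biaddNl m x : g (- m) x = - g m x.
Proof. by apply: (@addrI _ (g m x)); rewrite -gP.2 !subrr biadd0l. Qed.
Lemma biaddNr m x : g m (- x) = - g m x.
Proof. by apply: (@addrI _ (g m x)); rewrite -gP.1 !subrr biadd0r. Qed.
Lemma biadd_suml (I : Type) (r : seq I) (F : I -> M) x :
  g (\sum_(i <- r) F i) x = \sum_(i <- r) g (F i) x.
Proof. by apply: (big_morph (g^~ x)) => [a b|]; rewrite ?gP.2 ?biadd0l. Qed.
Lemma biadd_sumr (I : Type) (r : seq I) (F : I -> N) m :
  g m (\sum_(i <- r) F i) = \sum_(i <- r) g m (F i).
Proof. by apply: (big_morph (g m)) => [a b|]; rewrite ?gP.1 ?biadd0r. Qed.
End Biadditive.

Section WordGroup.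
Variables (M N : zmodType) (D : (M -> M) -> (N -> N) -> Prop).

(** A pair in [D] prescribes that [be] on the left factor equals [ga] on the right. Scalar actions
    give tensor products of modules, multiplications those of rings. *)
Definition dbalanced (Z : zmodType) (g : M -> N -> Z) :=
  biadditive g /\ forall be ga, D be ga -> forall b c, g (be b) c = g b (ga c).

Definition wsum (Z : zmodType) (g : M -> N -> Z) (w : seq (M * N)) : Z :=
  \sum_(x <- w) g x.1 x.2.

(* No balanced map separates the two words: the universal property of the quotient is then
   immediate, without generating a congruence. *)
Definition weq (w w' : seq (M * N)) : bool :=
  `[< forall (Z : zmodType) (g : M -> N -> Z), dbalanced g -> wsum g w = wsum g w' >].

Lemma weq_refl : reflexive weq. Proof. by move=> w; apply/asboolP. Qed.
Lemma weq_sym : symmetric weq.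
Proof. by move=> w w'; apply/asboolP/asboolP => H Z g /H. Qed.
Lemma weq_trans : transitive weq.
Proof. by move=> y x z /asboolP h1 /asboolP h2; apply/asboolP => Z g h; rewrite h1 ?h2. Qed.
Canonical weq_equiv := EquivRel weq weq_refl weq_sym weq_trans.

Definition words := {eq_quot weq}.
HB.instance Definition _ := Choice.on words.
HB.instance Definition _ := EqQuotient.on words.

(** Evaluation goes through the chosen representative; for balanced [g] the choice does not matter,
    by [wev_pi]. *)
Definition wev (Z : zmodType) (g : M -> N -> Z) (x : words) : Z := wsum g (repr x).
Definition wten (b : M) (c : N) : words := \pi_words [:: (b, c)].

Lemma wev_pi (Z : zmodType) (g : M -> N -> Z) w : dbalanced g -> wev g (\pi_words w) = wsum g w.
Proof.
move=> gP; have /eqmodP/asboolP E : repr (\pi_words w) = w %[mod words] by rewrite reprK.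
exact: E.
Qed.

Lemma words_ext (x y : words) :
  (forall (Z : zmodType) (g : M -> N -> Z), dbalanced g -> wev g x = wev g y) -> x = y.
Proof. by move=> H; rewrite -[x]reprK -[y]reprK; apply/eqmodP/asboolP. Qed.

Definition wadd (x y : words) : words := \pi_words (repr x ++ repr y).
Definition wopp (x : words) : words := \pi_words [seq (- z.1, z.2) | z <- repr x].
Definition wzero : words := \pi_words [::].

Lemma wev_add (Z : zmodType) (g : M -> N -> Z) x y :
  dbalanced g -> wev g (wadd x y) = wev g x + wev g y.
Proof. by move=> gP; rewrite wev_pi // /wsum big_cat. Qed.
Lemma wev_opp (Z : zmodType) (g : M -> N -> Z) x : dbalanced g -> wev g (wopp x) = - wev g x.
Proof.
move=> gP; rewrite wev_pi // /wev /wsum big_map /= -sumrN.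
by apply: eq_bigr => z _; rewrite (biaddNl gP.1).
Qed.
Lemma wev_zero (Z : zmodType) (g : M -> N -> Z) : dbalanced g -> wev g wzero = 0.
Proof. by move=> gP; rewrite wev_pi // /wsum big_nil. Qed.

Lemma waddA : associative wadd.
Proof. by move=> x y z; apply: words_ext => Z g gP; rewrite !wev_add // addrA. Qed.
Lemma waddC : commutative wadd.
Proof. by move=> x y; apply: words_ext => Z g gP; rewrite !wev_add // addrC. Qed.
Lemma wadd0 : left_id wzero wadd.
Proof. by move=> x; apply: words_ext => Z g gP; rewrite wev_add // wev_zero // add0r. Qed.
Lemma waddN : left_inverse wzero wopp wadd.
Proof.
by move=> x; apply: words_ext => Z g gP; rewrite wev_add // wev_opp // wev_zero // addNr.
Qed.
HB.instance Definition _ := GRing.isZmodule.Build words waddA waddC wadd0 waddN.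

Lemma wevD (Z : zmodType) (g : M -> N -> Z) : dbalanced g -> {morph wev g : x y / x + y}.
Proof. by move=> gP x y; apply: wev_add. Qed.
Lemma wev0 (Z : zmodType) (g : M -> N -> Z) : dbalanced g -> wev g 0 = 0.
Proof. exact: wev_zero. Qed.
Lemma wevN (Z : zmodType) (g : M -> N -> Z) : dbalanced g -> {morph wev g : x / - x}.
Proof. by move=> gP x; apply: wev_opp. Qed.
Lemma wev_sum (Z : zmodType) (g : M -> N -> Z) (I : Type) (r : seq I) (F : I -> words) :
  dbalanced g -> wev g (\sum_(i <- r) F i) = \sum_(i <- r) wev g (F i).
Proof. by move=> gP; apply: (big_morph _ (wevD gP) (wev0 gP)). Qed.
Lemma wev_ten (Z : zmodType) (g : M -> N -> Z) b c : dbalanced g -> wev g (wten b c) = g b c.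
Proof. by move=> gP; rewrite wev_pi // /wsum big_seq1. Qed.

Lemma wten_balanced : dbalanced wten.
Proof.
split; first split.
- by move=> m x y; apply: words_ext => Z g gP; rewrite wevD // !wev_ten // gP.1.1.
- by move=> m x y; apply: words_ext => Z g gP; rewrite wevD // !wev_ten // gP.1.2.
- by move=> be ga h b c; apply: words_ext => Z g gP; rewrite !wev_ten // (gP.2 _ _ h).
Qed.

Lemma words_repr (x : words) : x = \sum_(z <- repr x) wten z.1 z.2.
Proof.
apply: words_ext => Z g gP; rewrite wev_sum //.
by apply: eq_bigr => z _; rewrite wev_ten.
Qed.

Lemma words_ord (x : words) :
  exists n (m : 'I_n -> M) (b : 'I_n -> N), x = \sum_k wten (m k) (b k).
Proof.
exists (size (repr x)), (fun k => (tnth (in_tuple (repr x)) k).1),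
  (fun k => (tnth (in_tuple (repr x)) k).2).
by rewrite {1}[x]words_repr big_tnth.
Qed.

End WordGroup.

Section TensorOfModule.
Variables (A B : comPzRingType) (f : A -> B) (M : lmodType A).

Definition scal_rel (be : M -> M) (ga : B -> B) :=
  exists a, be = ( *:%R a) /\ ga = ( *%R (f a)).

Lemma scal_relP (Z : zmodType) (g : M -> B -> Z) :
  dbalanced scal_rel g <-> biadditive g /\ balanced f g.
Proof.
split=> -[gP h]; split=> //; first by move=> a m b; apply: (h ( *:%R a) ( *%R (f a))); exists a.
by move=> _ _ [a [-> ->]] b c; apply: h.
Qed.

Lemma wten_is_tensor : is_tensor f (wten scal_rel).
Proof.
have /scal_relP [h1 h2] := wten_balanced scal_rel; split; [exact: h1|split; [exact: h2|]].
move=> Z g g1 g2; have gP : dbalanced scal_rel g by apply/scal_relP.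
split.
  exists (wev g); split.
    exact: (wevD gP).
  by move=> m b; apply: wev_ten.
move=> h h' hD hD' hE hE' x; rewrite [x]words_repr.
have h0 (k : words scal_rel -> Z) : additive_fun k -> k 0 = 0.
  by move=> kD; apply: (@addrI _ (k 0)); rewrite -kD !addr0.
rewrite (big_morph h hD (h0 _ hD)) (big_morph h' hD' (h0 _ hD')).
by apply: eq_bigr => z _; rewrite hE hE'.
Qed.
End TensorOfModule.

Section ZmodQuotient.
Variables (V : zmodType) (W : V -> Prop).
Hypotheses (W0 : W 0) (WD : forall x y, W x -> W y -> W (x + y))
  (WN : forall x, W x -> W (- x)).

Definition zeq (x y : V) : bool := `[< W (x - y) >].
Lemma zeq_refl : reflexive zeq. Proof. by move=> x; apply/asboolP; rewrite subrr. Qed.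
Lemma zeq_sym : symmetric zeq.
Proof. by move=> x y; apply/asboolP/asboolP => /WN; rewrite opprB. Qed.
Lemma zeq_trans : transitive zeq.
Proof.
move=> y x z /asboolP h1 /asboolP h2; apply/asboolP.
by move: (WD h1 h2); rewrite addrA subrK.
Qed.
Definition zeq_equiv := EquivRel zeq zeq_refl zeq_sym zeq_trans.

(** Maps into such quotients serve below to test zero tensors. *)
Lemma zmod_quotient : exists (Q : zmodType) (pr : V -> Q),
  {morph pr : x y / x + y} /\ forall x, pr x = 0 <-> W x.
Proof.
pose T := {eq_quot zeq_equiv}.
have piE x y : \pi_T x = \pi_T y <-> W (x - y).
  by split=> [/eqmodP/asboolP//|h]; apply/eqmodP/asboolP.
have prK (x : V) : W (repr (\pi_T x) - x) by apply/piE; rewrite reprK.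
pose add (x y : T) : T := \pi_T (repr x + repr y).
pose opp (x : T) : T := \pi_T (- repr x).
have addE x y : \pi_T (x + y) = add (\pi_T x) (\pi_T y).
  apply/esym/piE; rewrite opprD addrACA; apply: WD; apply: prK.
have oppE x : \pi_T (- x) = opp (\pi_T x).
  apply/esym/piE; rewrite -opprD; apply: WN; apply: prK.
have surj (x : T) : exists v, x = \pi_T v by exists (repr x); rewrite reprK.
have addA : associative add.
  move=> x y z; have [[a ->] [b ->] [c ->]] := And3 (surj x) (surj y) (surj z).
  by rewrite -!addE addrA.
have addC : commutative add by move=> x y; rewrite /add addrC.
have add0 : left_id (\pi_T 0) add by move=> x; have [a ->] := surj x; rewrite -addE add0r.
have addN : left_inverse (\pi_T 0) opp add.
  by move=> x; have [a ->] := surj x; rewrite -oppE -addE addNr.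
pose m := GRing.isZmodule.Build T addA addC add0 addN.
pose Q : zmodType := HB.pack T m.
exists Q, \pi_T; split; first exact: addE.
by move=> x; rewrite -{2}[x]subr0; apply: piE.
Qed.
End ZmodQuotient.

Section TensorRing.
Variables (B C : comPzRingType) (D : B -> C -> Prop).

(* [D x y] imposes [x (x) 1 = 1 (x) y]. *)
Definition ring_rel (be : B -> B) (ga : C -> C) :=
  exists x y, [/\ D x y, be = *%R x & ga = *%R y].

Lemma ring_relP (Z : zmodType) (g : B -> C -> Z) :
  dbalanced ring_rel g <->
  biadditive g /\ forall x y, D x y -> forall b c, g (x * b) c = g b (y * c).
Proof.
split=> -[gP h]; split=> //.
  by move=> x y xy b c; apply: (h ( *%R x) ( *%R y)); exists x, y.
by move=> _ _ [x [y [xy -> ->]]] b c; apply: h.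
Qed.

Definition tensor := words ring_rel.
HB.instance Definition _ := GRing.Zmodule.on tensor.

Definition ten (b : B) (c : C) : tensor := wten ring_rel b c.
Definition tone : tensor := ten 1 1.
(** The product is formed on chosen representatives. By [wevM] a balanced map sees it as a double
    evaluation, so the ring laws follow from [words_ext]. *)
Definition tmul (x y : tensor) : tensor :=
  \sum_(a <- repr x) \sum_(b <- repr y) ten (a.1 * b.1) (a.2 * b.2).

Lemma eq_wev (Z : zmodType) (g g' : B -> C -> Z) (x : tensor) :
  (forall b c, g b c = g' b c) -> wev g x = wev g' x.
Proof. by move=> e; apply: eq_bigr => z _; rewrite e. Qed.

Section Translate.
Variables (Z : zmodType) (g : B -> C -> Z).
Hypothesis gP : dbalanced ring_rel g.

Lemma translate_balanced b c : dbalanced ring_rel (fun b' c' => g (b * b') (c * c')).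
Proof.
have /ring_relP [[gD gD'] gb] := gP; apply/ring_relP; split; first split.
- by move=> m x y; rewrite mulrDr gD.
- by move=> m m' x; rewrite mulrDr gD'.
- by move=> x y xy b' c'; rewrite mulrCA (gb _ _ xy) mulrCA.
Qed.

Lemma wev_translate_balanced (y : tensor) :
  dbalanced ring_rel (fun b c => wev (fun b' c' => g (b * b') (c * c')) y).
Proof.
have /ring_relP [[gD gD'] gb] := gP; apply/ring_relP; split; first split.
- by move=> m x z; rewrite /wev /wsum -big_split; apply: eq_bigr => k _; rewrite mulrDl gD.
- by move=> m m' z; rewrite /wev /wsum -big_split; apply: eq_bigr => k _; rewrite mulrDl gD'.
- by move=> x z xz b c; apply: eq_wev => b' c'; rewrite -!mulrA (gb _ _ xz).
Qed.

Lemma wevM (x y : tensor) :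
  wev g (tmul x y) = wev (fun b c => wev (fun b' c' => g (b * b') (c * c')) y) x.
Proof.
rewrite /tmul wev_sum //; apply: eq_bigr => a _.
by rewrite wev_sum //; apply: eq_bigr => b _; rewrite wev_ten.
Qed.
End Translate.

Lemma tmulA : associative tmul.
Proof.
move=> x y z; apply: words_ext => Z g gP.
rewrite wevM // [RHS]wevM // [RHS]wevM; last exact: wev_translate_balanced.
apply: eq_wev => b c; rewrite wevM; last exact: translate_balanced.
by apply: eq_wev => b' c'; apply: eq_wev => b'' c''; rewrite !mulrA.
Qed.
Lemma tmulC : commutative tmul.
Proof.
move=> x y; apply: words_ext => Z g gP; rewrite !wevM // /wev /wsum exchange_big.
by apply: eq_bigr => i _; apply: eq_bigr => j _; rewrite mulrC [_.2 * _]mulrC.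
Qed.
Lemma tmul1 : left_id tone tmul.
Proof.
move=> x; apply: words_ext => Z g gP; rewrite wevM // wev_ten.
  by apply: eq_wev => b c; rewrite !mul1r.
exact: wev_translate_balanced.
Qed.
Lemma tmulDl : left_distributive tmul +%R.
Proof.
move=> x y z; apply: words_ext => Z g gP.
by rewrite wevD // !wevM // wevD //; apply: wev_translate_balanced.
Qed.
HB.instance Definition _ := GRing.Zmodule_isComPzRing.Build tensor tmulA tmulC tmul1 tmulDl.

Lemma ten_biadditive : biadditive ten.
Proof. exact: (wten_balanced ring_rel).1. Qed.
Lemma ten_move x y b c : D x y -> ten (x * b) c = ten b (y * c).
Proof. by move=> xy; have /ring_relP [_ h] := wten_balanced ring_rel; apply: h. Qed.
Lemma tenM b c b' c' : ten b c * ten b' c' = ten (b * b') (c * c').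
Proof.
apply: words_ext => Z g gP; rewrite wevM // wev_ten; last exact: wev_translate_balanced.
by rewrite !wev_ten //; apply: translate_balanced.
Qed.
Lemma ten11 : ten 1 1 = 1. Proof. by []. Qed.
Lemma tenX b c n : ten b c ^+ n = ten (b ^+ n) (c ^+ n).
Proof. by elim: n => [|n IH]; rewrite ?expr0 ?ten11 // !exprS IH tenM. Qed.

Definition tenl (b : B) : tensor := ten b 1.
Definition tenr (c : C) : tensor := ten 1 c.
Lemma tenl_zmod : zmod_morphism tenl.
Proof. by move=> x y; rewrite /tenl ten_biadditive.2 (biaddNl ten_biadditive). Qed.
Lemma tenr_zmod : zmod_morphism tenr.
Proof. by move=> x y; rewrite /tenr ten_biadditive.1 (biaddNr ten_biadditive). Qed.
Lemma tenl_monoid : monoid_morphism tenl.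
Proof. by split=> // x y; rewrite /tenl tenM mulr1. Qed.
Lemma tenr_monoid : monoid_morphism tenr.
Proof. by split=> // x y; rewrite /tenr tenM mulr1. Qed.
HB.instance Definition _ := GRing.isZmodMorphism.Build B tensor tenl tenl_zmod.
HB.instance Definition _ := GRing.isZmodMorphism.Build C tensor tenr tenr_zmod.
HB.instance Definition _ := GRing.isMonoidMorphism.Build B tensor tenl tenl_monoid.
HB.instance Definition _ := GRing.isMonoidMorphism.Build C tensor tenr tenr_monoid.

Lemma tenE b c : ten b c = tenl b * tenr c.
Proof. by rewrite /tenl /tenr tenM mulr1 mul1r. Qed.

Lemma tensor_ord (x : tensor) :
  exists n (m : 'I_n -> B) (b : 'I_n -> C), x = \sum_k ten (m k) (b k).
Proof. exact: words_ord. Qed.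

Lemma tensor_zero (Z : zmodType) (g : B -> C -> Z) (I : finType) (m : I -> B) (b : I -> C) :
  biadditive g -> (forall x y, D x y -> forall b c, g (x * b) c = g b (y * c)) ->
  \sum_k ten (m k) (b k) = 0 -> \sum_k g (m k) (b k) = 0.
Proof.
move=> g1 g2 e; have gP : dbalanced ring_rel g by apply/ring_relP.
rewrite -[RHS](wev0 gP) -e wev_sum //; apply: eq_bigr => k _.
by rewrite wev_ten.
Qed.

Lemma tensor_lift (T : comPzRingType) (h1 : {rmorphism B -> T}) (h2 : {rmorphism C -> T}) :
  (forall x y, D x y -> h1 x = h2 y) ->
  exists h : {rmorphism tensor -> T}, forall b c, h (ten b c) = h1 b * h2 c.
Proof.
move=> hD; pose g b c := h1 b * h2 c.
have gP : dbalanced ring_rel g.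
  apply/ring_relP; rewrite /g; split; first split.
  - by move=> m x y; rewrite rmorphD mulrDr.
  - by move=> m x y; rewrite rmorphD mulrDl.
  - by move=> x y /hD e b c; rewrite !rmorphM e mulrCA mulrA.
pose h : tensor -> T := wev g.
have hN : zmod_morphism h by move=> x y; rewrite /h wevD // wevN.
have hM : monoid_morphism h.
  split; first by rewrite /h -ten11 wev_ten // /g !rmorph1 mulr1.
  move=> x y; rewrite /h wevM // /wev /wsum mulr_suml; apply: eq_bigr => i _.
  rewrite mulr_sumr; apply: eq_bigr => j _; rewrite /g !rmorphM; ring.
pose hr : {rmorphism tensor -> T} := HB.pack h
  (GRing.isZmodMorphism.Build _ _ h hN) (GRing.isMonoidMorphism.Build _ _ h hM).
by exists hr => b c; rewrite /= /h wev_ten.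
Qed.

Lemma tensor_rmorph_ext (T : comPzRingType) (h h' : {rmorphism tensor -> T}) :
  (forall b, h (tenl b) = h' (tenl b)) -> (forall c, h (tenr c) = h' (tenr c)) ->
  forall x, h x = h' x.
Proof.
move=> e1 e2 x; have [n [m [b ->]]] := tensor_ord x; rewrite !rmorph_sum.
by apply: eq_bigr => k _; rewrite tenE !rmorphM e1 e2.
Qed.

End TensorRing.

Section Pushout.
Variables (A B C : comPzRingType) (f : A -> B) (g : A -> C).

Definition base_rel (x : B) (y : C) := exists a, x = f a /\ y = g a.

Lemma base_rel_move (Z : zmodType) (h : B -> C -> Z) :
  (forall a b c, h (f a * b) c = h b (g a * c)) ->
  forall x y, base_rel x y -> forall b c, h (x * b) c = h b (y * c).
Proof. by move=> hP _ _ [a [-> ->]] b c. Qed.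

Lemma tensor_is_pushout : is_pushout f g (@tenl B C base_rel) (@tenr B C base_rel).
Proof.
split=> [a|T h1 h2 e].
  by rewrite /tenl /tenr -[f a]mulr1 -[g a]mulr1; apply: ten_move; exists a.
split; last by move=> h h' a1 a2 b1 b2; apply: tensor_rmorph_ext => z; rewrite ?a1 ?a2 ?b1 ?b2.
have [|h hE] := @tensor_lift B C base_rel T h1 h2; first by move=> _ _ [a [-> ->]].
by exists h; split=> z; rewrite hE rmorph1 ?mulr1 ?mul1r.
Qed.

Variables (P : comPzRingType) (i1 : {rmorphism B -> P}) (i2 : {rmorphism C -> P}).
Hypothesis HP : is_pushout f g i1 i2.

(** The composite of the comparison maps from [P] to the concrete tensor product and back is the
    identity, by uniqueness in the pushout property. *)
Lemma pushout_span (x : P) :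
  exists n (b : 'I_n -> B) (c : 'I_n -> C), x = \sum_k i1 (b k) * i2 (c k).
Proof.
have [|k kE] := @tensor_lift B C base_rel P i1 i2.
  by move=> _ _ [a [-> ->]]; apply: HP.1.
have [t1 _] := tensor_is_pushout.
have [[h [h1 h2]] _] := HP.2 _ _ _ t1.
have [_ u] := HP.2 _ i1 i2 HP.1.
have e : x = k (h x).
  have := u idfun (k \o h)%FUN; apply=> //= z; rewrite ?h1 ?h2 kE rmorph1 ?mulr1 ?mul1r //.
have [n [b [c E]]] := tensor_ord (h x); exists n, b, c.
by rewrite e E rmorph_sum; apply: eq_bigr => j _; rewrite kE.
Qed.

Lemma pushout_zero (Z : zmodType) (h : B -> C -> Z) (I : finType) (b : I -> B) (c : I -> C) :
  biadditive h -> (forall a b c, h (f a * b) c = h b (g a * c)) ->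
  \sum_k i1 (b k) * i2 (c k) = 0 -> \sum_k h (b k) (c k) = 0.
Proof.
move=> hP1 hP2 e; have [t1 _] := tensor_is_pushout.
have [[k [k1 k2]] _] := HP.2 _ _ _ t1.
apply: (tensor_zero hP1 (base_rel_move hP2)).
rewrite -[RHS](rmorph0 k) -e rmorph_sum; apply: eq_bigr => j _.
by rewrite rmorphM k1 k2 tenE.
Qed.
End Pushout.

(** * Equational criterion of flatness *)

Section FlatRelations.
Variables (A B : comPzRingType) (f : {rmorphism A -> B}) (N : lmodType A).
Variables (I : finType) (m : I -> N) (b : I -> B).

Definition in_span (x : N) : bool := `[< exists r : I -> A, x = \sum_k r k *: m k >].

Lemma in_span_submod : submod_closed in_span.
Proof.
split; first by apply/asboolP; exists (fun _ => 0); rewrite big1 // => k _; rewrite scale0r.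
move=> a x y /asboolP [r ->] /asboolP [r' ->]; apply/asboolP.
exists (fun k => a * r k + r' k); rewrite scaler_sumr -big_split.
by apply: eq_bigr => k _; rewrite scalerDl scalerA.
Qed.
HB.instance Definition _ := GRing.isSubmodClosed.Build A N in_span in_span_submod.

Definition span := {x : N | in_span x}.
HB.instance Definition _ := Choice.on span.
HB.instance Definition _ := SubType.on span.
HB.instance Definition _ := [SubChoice_isSubLmodule of span by <:].

(** The image in [B^I] of the module of [A]-relations among the [m k], tensored with [B]. *)
Definition relation_span (v : {ffun I -> B}) : Prop :=
  exists q (c : I -> 'I_q -> A) (b' : 'I_q -> B),
    (forall k, v k = \sum_j f (c k j) * b' j) /\ forall j, \sum_k c k j *: m k = 0.

Hypothesis flat_f : flat f.
(** This expresses the vanishing of sum_k m_k (x) b_k in [N (x)_A B] through balanced maps, without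
    fixing a model of the tensor product. *)
Hypothesis mb0 : forall (Z : zmodType) (g : N -> B -> Z), biadditive g -> balanced f g ->
  \sum_k g (m k) (b k) = 0.

Lemma in_span_gen k : in_span (m k).
Proof.
apply/asboolP; exists (fun l => (l == k)%:R); rewrite (bigD1 k) //= eqxx scale1r big1 ?addr0 //.
by move=> l /negPf ->; rewrite scale0r.
Qed.

Lemma span_sum_zero (Z : zmodType) (g : span -> B -> Z) : biadditive g -> balanced f g ->
  \sum_k g (Sub (m k) (in_span_gen k)) (b k) = 0.
Proof.
move=> g1 g2.
have [T1 [T2 T3]] := wten_is_tensor f span.
have [N1 [N2 N3]] := wten_is_tensor f N.
have u1 : biadditive (fun (x : span) c => wten (scal_rel f (M := N)) (val x) c).
  by split=> [x c c'|x y c]; rewrite ?N1.1 // raddfD N1.2.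
have u2 : balanced f (fun (x : span) c => wten (scal_rel f (M := N)) (val x) c).
  by move=> a x c; rewrite linearZ /= N2.
have [[h [hD hE]] _] := T3 _ _ u1 u2.
have vlin a (x y : span) : val (a *: x + y) = a *: val x + val y by rewrite linearP.
have hI := @flat_f span N val vlin val_inj _ _ _ _ (wten_is_tensor f span)
  (wten_is_tensor f N) h hD hE.
have h0 : h 0 = 0 by apply: (@addrI _ (h 0)); rewrite -hD !addr0.
have gP : dbalanced (scal_rel f (M := span)) g by apply/scal_relP.
set s := \sum_k _.
pose x := \sum_k wten (scal_rel f (M := span)) (Sub (m k) (in_span_gen k)) (b k).
have -> : s = wev g x by rewrite wev_sum //; apply: eq_bigr => k _; rewrite wev_ten.
suff -> : x = 0 by rewrite wev0.
apply: hI; rewrite h0 (big_morph h hD h0).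
rewrite -[RHS](mb0 N1 N2); apply: eq_bigr => k _.
by rewrite hE SubK.
Qed.

Lemma relation_span0 : relation_span 0.
Proof.
exists 0, (fun _ _ => 0), (fun _ => 0); split=> [k|[]//].
by rewrite big_ord0 ffunE.
Qed.
Lemma relation_spanD v w : relation_span v -> relation_span w -> relation_span (v + w).
Proof.
move=> [q [c [b1 [e1 e2]]]] [q' [c' [b1' [e1' e2']]]].
exists (q + q')%N, (fun k j => match split j with inl i => c k i | inr i => c' k i end),
  (fun j => match split j with inl i => b1 i | inr i => b1' i end); split.
  move=> k; rewrite ffunE e1 e1' big_split_ord /=; congr (_ + _); apply: eq_bigr => j _.
    by rewrite (unsplitK (inl j)).
  by rewrite (unsplitK (inr j)).
by move=> j; case: (split j).
Qed.
Lemma relation_spanN v : relation_span v -> relation_span (- v).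
Proof.
move=> [q [c [b1 [e1 e2]]]]; exists q, c, (fun j => - b1 j); split=> // k.
by rewrite ffunE e1 -sumrN; apply: eq_bigr => j _; rewrite mulrN.
Qed.
Lemma relation_span1 (r : I -> A) (c : B) : \sum_k r k *: m k = 0 ->
  relation_span [ffun k => f (r k) * c].
Proof.
move=> e; exists 1, (fun k _ => r k), (fun _ => c); split=> [k|//].
by rewrite big_ord1 ffunE.
Qed.

(* Equational criterion: apply injectivity of [span (x) B -> N (x) B], then test
   the resulting zero tensor of [span (x) B] against [B^I] modulo the relations. *)
Lemma flat_relations : exists q (c : I -> 'I_q -> A) (b' : 'I_q -> B),
  (forall k, b k = \sum_j f (c k j) * b' j) /\ forall j, \sum_k c k j *: m k = 0.
Proof.
have [Q [pr [prD pr0]]] := zmod_quotient relation_span0 relation_spanD relation_spanN.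
have prz : pr 0 = 0 by apply/pr0; apply: relation_span0.
have prN x : pr (- x) = - pr x by apply: (@addrI _ (pr x)); rewrite -prD !subrr.
have /choice [r rE] (x : span) : exists r : I -> A, val x = \sum_k r k *: m k.
  by case: x => x /= /asboolP.
(* Two choices of coordinates of [x] differ by a relation among the [m k], so modulo [relation_span]
   the value is independent of [r]. *)
pose g (x : span) c := pr [ffun k => f (r x k) * c].
have gE (r' : I -> A) (x : span) c : val x = \sum_k r' k *: m k ->
    g x c = pr [ffun k => f (r' k) * c].
  move=> e; apply/eqP; rewrite -subr_eq0 -prN -prD; apply/eqP/pr0.
  have e' : \sum_k (r x k - r' k) *: m k = 0.
    rewrite -[RHS](subrr (val x)) {1}rE e -sumrB.
    by apply: eq_bigr => k _; rewrite scalerBl.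
  by have := relation_span1 c e'; congr relation_span; apply/ffunP => k; rewrite !ffunE rmorphB mulrBl.
have g1 : biadditive g.
  split=> [x c c'|x y c].
    by rewrite /g -prD; congr pr; apply/ffunP => k; rewrite !ffunE mulrDr.
  rewrite (gE (fun k => r x k + r y k)) ?raddfD /=.
    by rewrite /g -prD; congr pr; apply/ffunP => k; rewrite !ffunE rmorphD mulrDl.
  by rewrite !rE -big_split; apply: eq_bigr => k _; rewrite scalerDl.
have g2 : balanced f g.
  move=> a x c; rewrite (gE (fun k => a * r x k)) ?linearZ /=.
    by rewrite /g; congr pr; apply/ffunP => k; rewrite !ffunE rmorphM -mulrA mulrCA.
  by rewrite rE scaler_sumr; apply: eq_bigr => k _; rewrite scalerA.
have := span_sum_zero g1 g2.
(* Unit vectors are coordinates of the [m k], so the vanishing sum is the class of [b] itself. *)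
have -> : \sum_k g (Sub (m k) (in_span_gen k)) (b k) = pr [ffun k => b k].
  transitivity (\sum_k pr [ffun l => (l == k)%:R * b k]).
    apply: eq_bigr => k _; rewrite (gE (fun l => (l == k)%:R)).
      by congr pr; apply/ffunP => l; rewrite !ffunE; case: eqP; rewrite ?rmorph1 ?rmorph0.
    rewrite SubK (bigD1 k) //= eqxx scale1r big1 ?addr0 //.
    by move=> l /negPf ->; rewrite scale0r.
  rewrite -(big_morph pr prD prz); congr pr; apply/ffunP => l.
  rewrite sum_ffunE ffunE (bigD1 l) //= ffunE eqxx mul1r big1 ?addr0 //.
  by move=> k; rewrite eq_sym ffunE => /negPf ->; rewrite mul0r.
move/pr0 => [q [c [b' [e1 e2]]]]; exists q, c, b'; split=> // k.
by rewrite -e1 ffunE.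
Qed.
End FlatRelations.

(** * Ideals *)

Record is_ideal (R : comPzRingType) (I : R -> Prop) : Prop := IsIdeal {
  ideal0 : I 0;
  idealD : forall x y, I x -> I y -> I (x + y);
  idealM : forall r x, I x -> I (r * x) }.

Section IdealTheory.
Variables (R : comPzRingType) (I : R -> Prop).
Hypothesis HI : is_ideal I.

Lemma ideal_mulr x r : I x -> I (x * r). Proof. by rewrite mulrC; apply: (idealM HI). Qed.
Lemma idealN x : I x -> I (- x). Proof. by rewrite -mulN1r; apply: (idealM HI). Qed.
Lemma idealB x y : I x -> I y -> I (x - y).
Proof. by move=> Ix /idealN; apply: (idealD HI). Qed.
Lemma idealBC x y : I (x - y) -> I (y - x).
Proof. by move/idealN; rewrite opprB. Qed.
Lemma ideal_sum (J : Type) (r : seq J) (P : pred J) (F : J -> R) :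
  (forall j, P j -> I (F j)) -> I (\sum_(j <- r | P j) F j).
Proof. by move=> h; apply: big_ind => //; [apply: (ideal0 HI)|apply: (idealD HI)]. Qed.
Lemma ideal_trans y x z : I (x - y) -> I (y - z) -> I (x - z).
Proof. by move=> h1 h2; have := idealD HI h1 h2; rewrite addrA subrK. Qed.
Lemma ideal_congr x y : I (x - y) -> I x <-> I y.
Proof.
move=> h; split=> [Ix|Iy]; last by rewrite -[x](subrK y); apply: (idealD HI).
by rewrite -[y](subKr x); apply: idealB.
Qed.
Lemma ideal_congrD x y x' y' : I (x - y) -> I (x' - y') -> I ((x + x') - (y + y')).
Proof. by move=> h h'; rewrite opprD addrACA; apply: (idealD HI). Qed.
Lemma ideal_congrM x y x' y' : I (x - y) -> I (x' - y') -> I (x * x' - y * y').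
Proof.
move=> h h'; have -> : x * x' - y * y' = x * (x' - y') + (x - y) * y' by ring.
by apply: (idealD HI); [apply: (idealM HI)|apply: ideal_mulr].
Qed.
Lemma ideal_congrX x y n : I (x - y) -> I (x ^+ n - y ^+ n).
Proof.
by move=> h; elim: n => [|n IH]; [rewrite subrr; apply: (ideal0 HI)|rewrite !exprS; apply: ideal_congrM].
Qed.
Lemma ideal_congr_sum (J : Type) (r : seq J) (F G : J -> R) :
  (forall j, I (F j - G j)) -> I (\sum_(j <- r) F j - \sum_(j <- r) G j).
Proof. by move=> h; rewrite -sumrB; apply: ideal_sum. Qed.

Variable p : nat.
Hypotheses (p_pr : prime p) (Ip : I p%:R).

Lemma ideal_exprD x y : I ((x + y) ^+ p - (x ^+ p + y ^+ p)).
Proof.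
case: p p_pr Ip => [//|q] q_pr Iq; rewrite exprDn big_ord_recl big_ord_recr /=.
rewrite !subn0 /bump /= !add1n subnn !expr0 bin0 binn !mulr1n mulr1 mul1r.
set s := (\sum_(i < q) _); have Is : I s.
  apply: ideal_sum => i _; have /dvdnP [k ->] : (q.+1 %| 'C(q.+1, i.+1))%N.
    by apply: prime_dvd_bin; rewrite //= ltnS.
  by rewrite mulrnA -mulr_natr; apply: (idealM HI).
set a := x ^+ _; set b := y ^+ _.
by have -> : a + (s + b) - (a + b) = s by ring.
Qed.

Lemma ideal_expr_sum (J : Type) (r : seq J) (F : J -> R) :
  I ((\sum_(j <- r) F j) ^+ p - \sum_(j <- r) F j ^+ p).
Proof.
elim: r => [|j r IH]; first by rewrite !big_nil expr0n gtn_eqF ?prime_gt0 // subrr; apply: (ideal0 HI).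
rewrite !big_cons; apply: (ideal_trans (ideal_exprD _ _)).
by apply: ideal_congrD => //; rewrite subrr; apply: (ideal0 HI).
Qed.
End IdealTheory.

Section Extension.
Variables (A B : comPzRingType) (f : A -> B) (I : A -> Prop).

Lemma ext_ideal : is_ideal (ext f I).
Proof.
split.
- by exists 0, (fun _ => 0), (fun _ => 0); split=> [[]//|]; rewrite big_ord0.
- move=> x y [n [a [r [aI ->]]]] [n' [a' [r' [aI' ->]]]].
  exists (n + n')%N, (fun j => match split j with inl i => a i | inr i => a' i end),
    (fun j => match split j with inl i => r i | inr i => r' i end); split.
    by move=> j; case: (split j).
  by rewrite big_split_ord /=; congr (_ + _); apply: eq_bigr => j _;
    rewrite ?(unsplitK (inl j)) ?(unsplitK (inr j)).
- move=> s x [n [a [r [aI ->]]]]; exists n, a, (fun j => s * r j); split=> //.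
  by rewrite mulr_sumr; apply: eq_bigr => j _; rewrite mulrCA.
Qed.

Lemma ext_gen a : I a -> ext f I (f a).
Proof. by move=> Ia; exists 1, (fun _ => a), (fun _ => 1); rewrite big_ord1 mulr1. Qed.

Lemma ext_min (K : B -> Prop) : is_ideal K -> (forall a, I a -> K (f a)) ->
  forall x, ext f I x -> K x.
Proof.
move=> HK h x [n [a [r [aI ->]]]]; apply: (ideal_sum HK) => j _.
by apply: (ideal_mulr HK); apply: h.
Qed.
End Extension.

(** * Relative Frobenius of a weakly etale map *)

Definition restrict (A B : comPzRingType) (f : {rmorphism A -> B}) : Type := B.

Section Restrict.
Variables (A B : comPzRingType) (f : {rmorphism A -> B}).
HB.instance Definition _ := GRing.Zmodule.on (restrict f).
Definition rscale (a : A) (x : restrict f) : restrict f := f a * (x : B).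
Lemma rscaleA a b x : rscale a (rscale b x) = rscale (a * b) x.
Proof. by rewrite /rscale rmorphM mulrA. Qed.
Lemma rscale1 : left_id 1 rscale. Proof. by move=> x; rewrite /rscale rmorph1 mul1r. Qed.
Lemma rscaleDr : right_distributive rscale +%R.
Proof. by move=> a x y; rewrite /rscale mulrDr. Qed.
Lemma rscaleDl x : {morph rscale^~ x : a b / a + b}.
Proof. by move=> a b; rewrite /rscale rmorphD mulrDl. Qed.
HB.instance Definition _ :=
  GRing.Zmodule_isLmodule.Build A (restrict f) rscaleA rscale1 rscaleDr rscaleDl.
End Restrict.

Lemma flat_ring_relations (A B N : comPzRingType) (f : {rmorphism A -> B})
    (h : {rmorphism A -> N}) (I : finType) (m : I -> N) (b : I -> B) :
  flat f ->
  (forall (Z : zmodType) (g : N -> B -> Z), biadditive g ->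
     (forall a x y, g (h a * x) y = g x (f a * y)) -> \sum_k g (m k) (b k) = 0) ->
  exists q (c : I -> 'I_q -> A) (b' : 'I_q -> B),
    (forall k, b k = \sum_j f (c k j) * b' j) /\ forall j, \sum_k h (c k j) * m k = 0.
Proof. by move=> ff H; apply: (flat_relations (N := restrict h) (m := m) ff). Qed.

Section WeaklyEtale.
Variables (A B : comPzRingType) (phi : {rmorphism A -> B}).
Hypothesis Het : weakly_etale phi.

Let BB := tensor (base_rel phi phi).

(* The kernel of the multiplication [BB -> B] is pure because that map is flat. *)
Lemma weakly_etale_diag : exists mu : {rmorphism BB -> B},
  (forall b c, mu (ten _ b c) = b * c) /\
  forall (I : finType) (x : I -> BB), (forall k, mu (x k) = 0) ->
    exists c, mu c = 1 /\ forall k, x k * c = 0.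
Proof.
have [|mu muE] := @tensor_lift B B (base_rel phi phi) B idfun idfun.
  by move=> _ _ [a [-> ->]].
exists mu; split=> // I x mux.
have mu1 b : mu (tenl _ b) = b by rewrite /tenl muE /= mulr1.
have mu2 b : mu (tenr _ b) = b by rewrite /tenr muE /= mul1r.
have fl := Het.2 _ _ _ (tensor_is_pushout phi phi) mu mu1 mu2.
(* In [BB (x)_BB B] the element x_k (x) 1 equals 1 (x) mu(x_k) = 0. The criterion gives 1 = sum_j
   mu(c_j) b_j with c_j x_k = 0; take c = sum_j c_j (b_j (x) 1). *)
have /choice [c cP] k : exists c, mu c = 1 /\ x k * c = 0.
  have [|q [c [b [e1 e2]]]] := @flat_ring_relations BB B BB mu idfun 'I_1
      (fun _ => x k) (fun _ => 1) fl.
    move=> Z g g1 g2; rewrite big_ord1 -[x k]mulr1 g2 mux mul0r.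
    exact: biadd0r.
  exists (\sum_j c ord0 j * tenl _ (b j)); split.
    rewrite rmorph_sum /= (e1 ord0); apply: eq_bigr => j _.
    by rewrite rmorphM mu1.
  rewrite mulr_sumr big1 // => j _; rewrite mulrA [x k * _]mulrC.
  by have := e2 j; rewrite big_ord1 /= => ->; rewrite mul0r.
exists (\prod_k c k); split.
  by rewrite rmorph_prod big1 // => k _; have [-> _] := cP k.
move=> k; rewrite (bigD1 k) //= mulrA; have [_ ->] := cP k.
by rewrite mul0r.
Qed.

Variable p : nat.
Hypothesis p_pr : prime p.

(** The subring phi(A)[B^p] + pB; including pB makes the p-th power additive up to elements of the
    span. *)
Inductive frob_span : B -> Prop :=
| FrobGen a e : frob_span (phi a * e ^+ p)
| FrobP v : frob_span (p%:R * v)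
| FrobAdd x y : frob_span x -> frob_span y -> frob_span (x + y).

Let pB (x : B) := exists v, x = p%:R * v.
Lemma pB_ideal : is_ideal pB.
Proof.
split; first by exists 0; rewrite mulr0.
- by move=> x y [v ->] [w ->]; exists (v + w); rewrite mulrDr.
- by move=> r x [v ->]; exists (r * v); rewrite mulrCA.
Qed.
Lemma pB_p : pB p%:R. Proof. by exists 1; rewrite mulr1. Qed.

Lemma frob_spanM x y : frob_span x -> frob_span y -> frob_span (x * y).
Proof.
elim=> [a e|v|x1 x2 _ h1 _ h2 yP]; last by rewrite mulrDl; apply: FrobAdd; auto.
  elim=> [b d|v|y1 y2 _ h1 _ h2]; last by rewrite mulrDr; apply: FrobAdd; auto.
    have -> : phi a * e ^+ p * (phi b * d ^+ p) = phi (a * b) * (e * d) ^+ p.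
      by rewrite rmorphM exprMn; ring.
    exact: FrobGen.
  by rewrite mulrCA; apply: FrobP.
by move=> _; rewrite -mulrA; apply: FrobP.
Qed.
Lemma frob_span_pow e : frob_span (e ^+ p).
Proof. by rewrite -[e ^+ p]mul1r -(rmorph1 phi); apply: FrobGen. Qed.
Lemma frob_span_sum (I : Type) (r : seq I) (F : I -> B) :
  (forall i, frob_span (F i)) -> frob_span (\sum_(i <- r) F i).
Proof.
move=> h; apply: big_ind => //; last exact: FrobAdd.
by rewrite -(mulr0 p%:R); apply: FrobP.
Qed.
Lemma frob_span_mod x y : pB (x - y) -> frob_span y -> frob_span x.
Proof. by move=> [v e] yP; rewrite -(subrK y x) e; apply: FrobAdd => //; apply: FrobP. Qed.
Lemma frob_spanX x n : frob_span x -> frob_span (x ^+ n).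
Proof.
move=> h; elim: n => [|n IH]; last by rewrite exprS; apply: frob_spanM.
by rewrite expr0 -(expr1n _ p); apply: frob_span_pow.
Qed.

Lemma rel_frob_surj b : frob_span b.
Proof.
have [mu [muE muP]] := weakly_etale_diag.
pose d : BB := ten _ b 1 - ten _ 1 b.
have [|c [muc]] := muP 'I_1 (fun _ => d).
  by move=> _; rewrite /d rmorphB !muE mulr1 mul1r subrr.
move/(_ ord0) => dc.
have [n [u [v cE]]] := tensor_ord c.
have IP := pB_ideal.
have muc' : \sum_l u l * v l = 1.
  by rewrite -muc cE rmorph_sum; apply: eq_bigr => l _; rewrite muE.
pose I0 (x : BB) := exists v, x = p%:R * v.
have I0P : is_ideal I0.
  split; first by exists 0; rewrite mulr0.
    by move=> x y [x' ->] [y' ->]; exists (x' + y'); rewrite mulrDr.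
  by move=> r x [x' ->]; exists (r * x'); rewrite mulrCA.
have I0p : I0 p%:R by exists 1; rewrite mulr1.
(* Since p > 0, d c = 0 gives d c^p = 0, and c^p agrees modulo p with the sum of the p-th powers. *)
have [e eE] : I0 (d * \sum_l ten _ (u l ^+ p) (v l ^+ p)).
  have : I0 (d * (c ^+ p - \sum_l ten _ (u l ^+ p) (v l ^+ p))).
    apply: (idealM I0P); rewrite cE; under [X in _ - X]eq_bigr do rewrite -tenX.
    exact: ideal_expr_sum.
  have -> : d * (c ^+ p - \sum_l ten _ (u l ^+ p) (v l ^+ p)) =
     - (d * \sum_l ten _ (u l ^+ p) (v l ^+ p)).
    rewrite mulrBr -(prednK (prime_gt0 p_pr)) exprS mulrA dc mul0r prednK ?prime_gt0 //.
    by rewrite sub0r.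
  by move/(idealN I0P); rewrite opprK.
have [q [E [E' eE']]] := tensor_ord e.
(* The leftover multiple of p becomes a third block of terms, so that the relation in [B (x)_A B] is
   exact and the criterion applies. *)
pose I := ('I_n + 'I_n + 'I_q)%type.
pose m (k : I) : B := match k with inl (inl l) => b * u l ^+ p | inl (inr l) => - u l ^+ p
   | inr j => - (p%:R * E j) end.
pose w (k : I) : B := match k with inl (inl l) => v l ^+ p | inl (inr l) => b * v l ^+ p
   | inr j => E' j end.
have tD := ten_biadditive (base_rel phi phi).
have T0 : \sum_k ten (base_rel phi phi) (m k) (w k) = 0.
  rewrite !big_sumType /=.
  transitivity (d * (\sum_l ten _ (u l ^+ p) (v l ^+ p)) - p%:R * e); last by rewrite eE subrr.
  rewrite /d mulrBl !mulr_sumr eE' mulr_sumr -!sumrN; congr (_ + _ + _).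
  - by apply: eq_bigr => l _; rewrite tenM mul1r.
  - by apply: eq_bigr => l _; rewrite tenM mul1r (biaddNl tD).
  - apply: eq_bigr => l _; rewrite (biaddNl tD); congr (- _).
    by rewrite -(rmorph_nat (tenl (base_rel phi phi))) /tenl tenM mul1r.
have [|r [cc [w' [e1 e2]]]] := @flat_ring_relations A B B phi phi I m w Het.1.
  move=> Z g g1 g2; apply: (tensor_zero g1 _ T0); exact: base_rel_move.
pose Dj j := \sum_l phi (cc (inl (inl l)) j) * u l ^+ p.
pose Cj j := \sum_l phi (cc (inl (inr l)) j) * u l ^+ p.
have DjP j : frob_span (Dj j) by apply: frob_span_sum => l; apply: FrobGen.
have CjP j : frob_span (Cj j) by apply: frob_span_sum => l; apply: FrobGen.
have bD j : pB (b * Dj j - Cj j).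
  have := e2 j; rewrite !big_sumType /= => e3.
  exists (\sum_l phi (cc (inr l) j) * E l).
  apply/eqP; rewrite -subr_eq0 -[X in _ == X]e3 /Dj /Cj !mulr_sumr -!sumrN; apply/eqP.
  by congr (_ + _ + _); apply: eq_bigr => l _; ring.
have one : pB (1 - \sum_j Dj j ^+ p * w' j ^+ p).
  have h1 : pB (1 - \sum_l (u l * v l) ^+ p).
    by rewrite -[X in X - _](expr1n _ p) -muc'; apply: ideal_expr_sum IP _ p_pr pB_p _ _ _.
  have h2 : \sum_l (u l * v l) ^+ p = \sum_j Dj j * w' j.
    under [RHS]eq_bigr do rewrite mulr_suml.
    rewrite exchange_big; apply: eq_bigr => l _.
    have /= e1' := e1 (inl (inl l)); rewrite exprMn e1' mulr_sumr; apply: eq_bigr => j _; ring.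
  (* A second p-th power replaces w'_j by w'_j^p, which lies in [frob_span], and D_j by D_j^p, one
     factor of which absorbs b. *)
  have h3 := ideal_congrX IP p h1; rewrite expr1n h2 in h3.
  apply: (ideal_trans IP h3); under [X in _ - X]eq_bigr do rewrite -exprMn.
  exact: ideal_expr_sum IP _ p_pr pB_p _ _ _.
have : frob_span (\sum_j Cj j * Dj j ^+ p.-1 * w' j ^+ p).
  apply: frob_span_sum => j; apply: frob_spanM; last exact: frob_span_pow.
  by apply: frob_spanM => //; apply: frob_spanX.
apply: frob_span_mod; rewrite -[b]mulr1.
have := idealM IP b one; rewrite mulrBr => h; apply: (ideal_trans IP h).
rewrite mulr_sumr; apply: (ideal_congr_sum IP) => j.
have -> : Dj j ^+ p = Dj j * Dj j ^+ p.-1 by rewrite -exprS prednK ?prime_gt0.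
set y := _ - _; have -> : y = (b * Dj j - Cj j) * (Dj j ^+ p.-1 * w' j ^+ p) by rewrite /y; ring.
by apply: (ideal_mulr IP); apply: bD.
Qed.

Variable I0 : A -> Prop.
Hypothesis I0p : I0 p%:R.

Definition frob_rel (x : A) (y : B) := (exists r, x = r ^+ p /\ y = phi r) \/ (I0 x /\ y = 0).

(* The Frobenius twist [A/I0 (x)_{Frob, A} B]: reduction modulo [I0] is part of the relations. *)
Let Bp := tensor frob_rel.

Lemma frob_twist_ideal a b : I0 a -> ten frob_rel a b = 0.
Proof.
move=> Ia; rewrite -[a]mulr1 (@ten_move _ _ _ a 0); last by right.
by rewrite mul0r (biadd0r (ten_biadditive _)).
Qed.

Lemma frob_twist_char : p%:R = 0 :> Bp.
Proof. by rewrite -(rmorph_nat (tenl frob_rel)); apply: frob_twist_ideal. Qed.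

Lemma frob_twist_pow r b : ten frob_rel (r ^+ p) b = ten frob_rel 1 (phi r * b).
Proof. by rewrite -[_ ^+ p]mulr1; apply: ten_move; left; exists r. Qed.

Lemma exprp_sum (R : comPzRingType) (I : Type) (r : seq I) (F : I -> R) :
  p%:R = 0 :> R -> (\sum_(j <- r) F j) ^+ p = \sum_(j <- r) F j ^+ p.
Proof.
move=> p0; apply/eqP; rewrite -subr_eq0; apply/eqP.
apply: (ideal_expr_sum (I := fun x => x = 0)) => //; split=> // [x y -> ->|s x ->].
  by rewrite addr0.
by rewrite mulr0.
Qed.

Lemma rel_frob_inj (I : finType) (a : I -> A) (b : I -> B) :
  ext phi I0 (\sum_k phi (a k) * b k ^+ p) -> \sum_k ten frob_rel (a k) (b k) = 0.
Proof.
move=> ab0; set x := \sum_k _.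
have [mu [muE muP]] := weakly_etale_diag.
have [|c [muc bc]] := muP I (fun k => ten _ (b k) 1 - ten _ 1 (b k)).
  by move=> k; rewrite rmorphB !muE mulr1 mul1r subrr.
have [n [u [v cE]]] := tensor_ord c.
have tD := ten_biadditive frob_rel.
have muc' : \sum_l u l * v l = 1.
  by rewrite -muc cE rmorph_sum; apply: eq_bigr => l _; rewrite muE.
(* The element sum_l x (1 (x) u_l) (x) v_l^p vanishes in [Bp (x)_A B], where [A] acts on [Bp]
   through [tenl]. *)
have key (Z : zmodType) (g : Bp -> B -> Z) : biadditive g ->
    (forall r y w, g (tenl frob_rel r * y) w = g y (phi r * w)) ->
    \sum_l g (x * ten _ 1 (u l)) (v l ^+ p) = 0.
  move=> g1 g2.
  have gI r y w : I0 r -> g y (phi r * w) = 0.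
    by move=> Ir; rewrite -g2 /tenl frob_twist_ideal // mul0r (biadd0l g1).
  have gI' y w : ext phi I0 w -> g y w = 0.
    move=> [k [d [e [dI ->]]]]; rewrite (biadd_sumr g1) big1 // => j _; exact: gI.
  have gp y w w' : g y ((w + w') ^+ p) = g y (w ^+ p) + g y (w' ^+ p).
    rewrite -g1.1; apply/eqP; rewrite -subr_eq0 -(biaddNr g1) -g1.1; apply/eqP/gI'.
    apply: ideal_exprD (ext_ideal _ _) _ p_pr _ _ _.
    by rewrite -(rmorph_nat phi); apply: ext_gen.
  (* Apply G(y, w) = g(a_k (x) y, w^p) to (b_k (x) 1 - 1 (x) b_k) c = 0. [G] is additive in w
     because [g] kills I_0, and balanced over [A] by the Frobenius relation in [Bp]. *)
  have swap k : \sum_l g (ten frob_rel (a k) (b k * u l)) (v l ^+ p) =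
      \sum_l g (ten frob_rel (a k) (u l)) (b k ^+ p * v l ^+ p).
    pose G y w := g (ten frob_rel (a k) y) (w ^+ p).
    have G1 : biadditive G.
      by split=> [y w w'|y y' w]; rewrite /G ?gp // tD.1 g1.2.
    have G2 r y w : G (phi r * y) w = G y (phi r * w).
      rewrite /G exprMn -[phi r ^+ p](rmorphXn phi) -g2 /tenl tenM mul1r; congr (g _ _).
      by rewrite -(@ten_move _ _ _ (r ^+ p) (phi r)) //; left; exists r.
    have T0 : \sum_(z : 'I_n + 'I_n) ten (base_rel phi phi)
        (match z with inl l => b k * u l | inr l => - u l end)
        (match z with inl l => v l | inr l => b k * v l end) = 0.
      rewrite big_sumType /=; transitivity ((ten (base_rel phi phi) (b k) 1 - ten _ 1 (b k)) * c).
        rewrite cE mulrBl !mulr_sumr -sumrN; congr (_ + _); apply: eq_bigr => l _.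
          by rewrite tenM mul1r.
        by rewrite tenM mul1r (biaddNl (ten_biadditive _)).
      exact: bc.
    have := tensor_zero G1 (base_rel_move G2) T0.
    rewrite big_sumType /= => /eqP; under [X in _ + X]eq_bigr do rewrite (biaddNl G1).
    rewrite sumrN subr_eq0 => /eqP; rewrite /G => ->.
    by apply: eq_bigr => l _; rewrite exprMn.
  (* Moving a_k to the right as well gathers sum_k phi(a_k) b_k^p in the second slot; it lies in I_0
     B, which [g] kills. *)
  transitivity (\sum_l g (tenr frob_rel (u l)) ((\sum_k phi (a k) * b k ^+ p) * v l ^+ p)).
    transitivity (\sum_l \sum_k g (ten frob_rel (a k) (b k * u l)) (v l ^+ p)).
      apply: eq_bigr => l _; rewrite mulr_suml (biadd_suml g1).
      by apply: eq_bigr => k _; rewrite tenM mulr1.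
    rewrite exchange_big; under eq_bigr do rewrite swap.
    rewrite exchange_big; apply: eq_bigr => l _; rewrite mulr_suml (biadd_sumr g1).
    apply: eq_bigr => k _; rewrite -mulrA -g2 /tenl /tenr tenM mulr1.
    by rewrite mul1r.
  by apply: big1 => l _; apply: gI'; apply: (ideal_mulr (ext_ideal _ _)).
have [q [cc [w [e1 e2]]]] := @flat_ring_relations A B Bp phi (tenl frob_rel) _ _ _ Het.1 key.
pose Cj j := \sum_l ten frob_rel (cc l j) (u l).
have xC j : x * Cj j = 0.
  rewrite -[RHS](e2 j) mulr_sumr; apply: eq_bigr => l _.
  by rewrite mulrCA /tenl tenM mulr1 mul1r.
(* In [Bp] the p-th power is additive and sends c (x) u to 1 (x) phi(c) u^p; the coefficients thus
   recombine to sum_l 1 (x) (u_l v_l)^p. *)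
have one : \sum_j Cj j ^+ p * tenr frob_rel (w j) = 1.
  transitivity (\sum_j \sum_l tenr frob_rel (u l ^+ p * (phi (cc l j) * w j))).
    apply: eq_bigr => j _; rewrite exprp_sum ?frob_twist_char // mulr_suml.
    apply: eq_bigr => l _; rewrite tenX frob_twist_pow /tenr tenM mulr1.
    by congr (ten _ _ _); ring.
  rewrite exchange_big; under eq_bigr do rewrite -rmorph_sum -mulr_sumr -e1 -exprMn rmorphXn.
  by rewrite -exprp_sum ?frob_twist_char // -rmorph_sum muc' rmorph1 expr1n.
rewrite -[x]mulr1 -one mulr_sumr big1 // => j _.
by rewrite -(prednK (prime_gt0 p_pr)) exprS -mulrA mulrA xC mul0r.
Qed.

(** [kap] inverts a (x) b -> phi(a) b^p modulo I_0. It is built as a relation [H], total by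
    [rel_frob_surj] and single-valued by [rel_frob_inj]. *)
Lemma rel_frob_inverse : exists kap : B -> Bp,
  [/\ forall x y, kap (x + y) = kap x + kap y,
      forall a b, kap (phi a * b) = tenl frob_rel a * kap b,
      forall b, kap (b ^+ p) = tenr frob_rel b &
      forall b, ext phi I0 b -> kap b = 0].
Proof.
have IP := ext_ideal phi I0.
pose H (b : B) (x : Bp) := exists w : seq (A * B), x = \sum_(z <- w) ten frob_rel z.1 z.2 /\
  ext phi I0 (b - \sum_(z <- w) phi z.1 * z.2 ^+ p).
have HD b x b' x' : H b x -> H b' x' -> H (b + b') (x + x').
  move=> [w [-> h]] [w' [-> h']]; exists (w ++ w'); rewrite !big_cat; split=> //.
  exact: (ideal_congrD IP).
have H0 x : H 0 x -> x = 0.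
  move=> [w [-> h]]; rewrite big_tnth; apply: rel_frob_inj.
  by move: h; rewrite sub0r big_tnth => /(idealN IP); rewrite opprK.
have HM a b x : H b x -> H (phi a * b) (tenl frob_rel a * x).
  move=> [w [-> h]]; exists [seq (a * z.1, z.2) | z <- w]; rewrite !big_map; split.
    by rewrite mulr_sumr; apply: eq_bigr => z _; rewrite /tenl tenM mul1r.
  under [X in _ - X]eq_bigr do rewrite /= rmorphM -mulrA.
  by rewrite -mulr_sumr -mulrBr; apply: (idealM IP).
have HN b x : H b x -> H (- b) (- x).
  by move/(HM (-1)); rewrite !rmorphN !rmorph1 !mulN1r.
have Hu b x x' : H b x -> H b x' -> x = x'.
  move=> h /HN h'; apply/eqP; rewrite -subr_eq0; apply/eqP/H0.
  by rewrite -(subrr b); apply: HD.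
have Hp b : H (b ^+ p) (tenr frob_rel b).
  exists [:: (1, b)]; rewrite !big_seq1 /= rmorph1 mul1r subrr; split=> //; exact: (ideal0 IP).
have HI b : ext phi I0 b -> H b 0.
  by move=> bI; exists [::]; rewrite !big_nil subr0.
have Ht b : exists x, H b x.
  elim: (rel_frob_surj b) => [a e|v|x y _ [x' h] _ [y' h']].
  - by exists (tenl frob_rel a * tenr frob_rel e); apply: HM.
  - exists 0; apply: HI; apply: (ideal_mulr IP).
    by rewrite -(rmorph_nat phi); apply: ext_gen.
  - by exists (x' + y'); apply: HD.
have [kap kP] := choice Ht; exists kap; split=> [x y|a b|b|b /HI h].
- exact: Hu (kP _) (HD _ _ _ _ (kP _) (kP _)).
- exact: Hu (kP _) (HM _ _ _ (kP _)).
- exact: Hu (kP _) (Hp _).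
- exact: Hu (kP _) h.
Qed.

End WeaklyEtale.

(** * Ideals in flat base changes *)

Section PushoutIdeals.
Variables (A B C P : comPzRingType) (f : {rmorphism A -> B}) (g : {rmorphism A -> C}).
Variables (i1 : {rmorphism B -> P}) (i2 : {rmorphism C -> P}).
Hypothesis HP : is_pushout f g i1 i2.

(** The image of K (x) C in [P]. For an ideal [K] it is the extension of [K], in a form that allows
    induction on pure tensors. *)
Inductive gen_span (K : B -> Prop) : P -> Prop :=
| GenSpan b c : K b -> gen_span K (i1 b * i2 c)
| GenSpan0 : gen_span K 0
| GenSpanD x y : gen_span K x -> gen_span K y -> gen_span K (x + y).

Lemma gen_span_sum K (I : Type) (r : seq I) (F : I -> P) :
  (forall k, gen_span K (F k)) -> gen_span K (\sum_(k <- r) F k).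
Proof. by move=> h; apply: big_ind => //; [apply: GenSpan0|apply: GenSpanD]. Qed.

Lemma gen_span_ext K x : gen_span K x -> ext i1 K x.
Proof.
have IP := ext_ideal i1 K; elim=> [b c Kb||y z _ h _ h'].
- by apply: (ideal_mulr IP); apply: ext_gen.
- exact: (ideal0 IP).
- exact: (idealD IP).
Qed.

Lemma ext_gen_span K x : is_ideal K -> ext i1 K x -> gen_span K x.
Proof.
move=> KI [n [a [r [aK ->]]]]; apply: gen_span_sum => k.
have [m [b [c ->]]] := pushout_span HP (r k); rewrite mulr_sumr; apply: gen_span_sum => j.
by rewrite mulrA -rmorphM; apply: GenSpan; apply: (ideal_mulr KI).
Qed.

Lemma gen_span_ord K x : gen_span K x ->
  exists n (b : 'I_n -> B) (c : 'I_n -> C), (forall k, K (b k)) /\ x = \sum_k i1 (b k) * i2 (c k).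
Proof.
elim=> [b c Kb||y z _ [n [b [c [bK ->]]]] _ [n' [b' [c' [bK' ->]]]]].
- by exists 1, (fun _ => b), (fun _ => c); rewrite big_ord1.
- by exists 0, (fun _ => 0), (fun _ => 0); rewrite big_ord0; split=> // -[].
- exists (n + n')%N, (fun j => match split j with inl i => b i | inr i => b' i end),
    (fun j => match split j with inl i => c i | inr i => c' i end); split.
    by move=> j; case: (split j).
  by rewrite big_split_ord /=; congr (_ + _); apply: eq_bigr => j _;
    rewrite ?(unsplitK (inl j)) ?(unsplitK (inr j)).
Qed.

Lemma ext_total x : ext i1 (fun _ => True) x.
Proof.
have [n [b [c ->]]] := pushout_span HP x; apply: gen_span_ext; apply: gen_span_sum => k.
exact: GenSpan.
Qed.

Lemma ext_sub (K L : B -> Prop) x : (forall b, K b -> L b) -> ext i1 K x -> ext i1 L x.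
Proof. by move=> h [n [a [r [aK ->]]]]; exists n, a, r; split=> // k; apply: h. Qed.

(** This plays the part of the isomorphism of P / K P with (B / K) (x) C: subtracting pure tensors
    with left entries in [K] leaves a zero tensor, and [h] kills what was subtracted. *)
Lemma pushout_zero_mod (Z : zmodType) (h : B -> C -> Z) (K : B -> Prop) (I : finType)
    (b : I -> B) (c : I -> C) :
  is_ideal K -> biadditive h -> (forall a b c, h (f a * b) c = h b (g a * c)) ->
  (forall b c, K b -> h b c = 0) ->
  ext i1 K (\sum_k i1 (b k) * i2 (c k)) -> \sum_k h (b k) (c k) = 0.
Proof.
move=> KI h1 h2 hK /(ext_gen_span KI)/gen_span_ord [n [b' [c' [b'K e]]]].
pose bb (k : I + 'I_n) := match k with inl k => b k | inr l => - b' l end.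
pose cc (k : I + 'I_n) := match k with inl k => c k | inr l => c' l end.
have : \sum_k i1 (bb k) * i2 (cc k) = 0.
  rewrite big_sumType /= e; under [X in _ + X]eq_bigr do rewrite rmorphN mulNr.
  by rewrite sumrN subrr.
move/(pushout_zero HP h1 h2); rewrite big_sumType /= [X in _ + X]big1 ?addr0 // => l _.
by rewrite (biaddNl h1) hK ?oppr0.
Qed.

Hypothesis fl : flat g.

(** The equational criterion for the module B / K. The pure tensors with left entries in [K] join
    the relation and afterwards contribute only elements of [K]. *)
Lemma pushout_flat (K : B -> Prop) (I : finType) (b : I -> B) (c : I -> C) :
  is_ideal K -> ext i1 K (\sum_k i1 (b k) * i2 (c k)) ->
  exists q (r : I -> 'I_q -> A) (c' : 'I_q -> C),
    (forall k, c k = \sum_j g (r k j) * c' j) /\ forall j, K (\sum_k f (r k j) * b k).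
Proof.
move=> KI /(ext_gen_span KI)/gen_span_ord [n [b' [c' [b'K e]]]].
pose bb (k : I + 'I_n) := match k with inl k => b k | inr l => - b' l end.
pose cc (k : I + 'I_n) := match k with inl k => c k | inr l => c' l end.
have e0 : \sum_k i1 (bb k) * i2 (cc k) = 0.
  rewrite big_sumType /= e; under [X in _ + X]eq_bigr do rewrite rmorphN mulNr.
  by rewrite sumrN subrr.
have [|q [r [w [e1 e2]]]] := @flat_ring_relations A C B g f _ bb cc fl.
  by move=> Z h h1 h2; apply: (pushout_zero HP h1 h2 e0).
exists q, (fun k => r (inl k)), w; split=> [k|j]; first exact: (e1 (inl k)).
have := e2 j; rewrite big_sumType /=; under [X in _ + X]eq_bigr do rewrite mulrN.
rewrite sumrN => /eqP; rewrite subr_eq0 => /eqP ->.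
by apply: (ideal_sum KI) => l _; apply: (idealM KI).
Qed.
End PushoutIdeals.

(* Flatness commutes with preimages and intersections of ideals. *)
Lemma pushout_preimage (A B B' C P P' : comPzRingType) (f : {rmorphism A -> B})
    (f' : {rmorphism A -> B'}) (g : {rmorphism A -> C})
    (i1 : {rmorphism B -> P}) (i2 : {rmorphism C -> P})
    (j1 : {rmorphism B' -> P'}) (j2 : {rmorphism C -> P'})
    (h : {additive B -> B'}) (H : {additive P -> P'}) (L : B -> Prop) (M : B' -> Prop) z :
  is_pushout f g i1 i2 -> is_pushout f' g j1 j2 -> flat g ->
  (forall a b, h (f a * b) = f' a * h b) ->
  (forall b c, H (i1 b * i2 c) = j1 (h b) * j2 c) ->
  is_ideal L -> is_ideal M ->
  ext i1 L z -> ext j1 M (H z) -> ext i1 (fun b => L b /\ M (h b)) z.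
Proof.
move=> HP HP' fl hf Hh LI MI /(ext_gen_span HP LI)/gen_span_ord [n [b [c [bL ->]]]].
rewrite raddf_sum; under eq_bigr do rewrite Hh.
move/(pushout_flat HP' fl MI) => [q [r [c' [e1 e2]]]].
(* Regrouped along the c'_j, the left entries stay in [L], and by the criterion their images under
   [h] lie in [M]. *)
have -> : \sum_k i1 (b k) * i2 (c k) = \sum_j i1 (\sum_k f (r k j) * b k) * i2 (c' j).
  under [RHS]eq_bigr do rewrite rmorph_sum mulr_suml.
  rewrite exchange_big; apply: eq_bigr => k _; rewrite e1 rmorph_sum mulr_sumr.
  by apply: eq_bigr => j _; rewrite !rmorphM -HP.1; ring.
apply: gen_span_ext; apply: gen_span_sum => j; apply: GenSpan; split.
  by apply: (ideal_sum LI) => k _; apply: (idealM LI).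
by rewrite raddf_sum; under eq_bigr do rewrite hf.
Qed.

Lemma idl_add_ideal (R : comPzRingType) (I J : R -> Prop) :
  is_ideal I -> is_ideal J -> is_ideal (idl_add I J).
Proof.
move=> II JI; split.
- exists 0, 0; rewrite addr0; split; [exact: (ideal0 II)|split=> //; exact: (ideal0 JI)].
- move=> _ _ [a [b [aI [bJ ->]]]] [a' [b' [aI' [bJ' ->]]]]; exists (a + a'), (b + b').
  by rewrite addrACA; do !split=> //; [apply: (idealD II)|apply: (idealD JI)].
- move=> r _ [a [b [aI [bJ ->]]]]; exists (r * a), (r * b); rewrite mulrDr.
  by do !split=> //; [apply: (idealM II)|apply: (idealM JI)].
Qed.
Lemma idl_addl (R : comPzRingType) (I J : R -> Prop) x : is_ideal J -> I x -> idl_add I J x.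
Proof. by move=> JI Ix; exists x, 0; rewrite addr0; do !split=> //; apply: (ideal0 JI). Qed.
Lemma idl_addr (R : comPzRingType) (I J : R -> Prop) x : is_ideal I -> J x -> idl_add I J x.
Proof. by move=> II Jx; exists 0, x; rewrite add0r; do !split=> //; apply: (ideal0 II). Qed.
Lemma idl_add_min (R : comPzRingType) (I J K : R -> Prop) : is_ideal K ->
  (forall x, I x -> K x) -> (forall x, J x -> K x) -> forall x, idl_add I J x -> K x.
Proof. by move=> KI hI hJ _ [a [b [/hI aK [/hJ bK ->]]]]; apply: (idealD KI). Qed.

Lemma ext_idl_add (B P : comPzRingType) (f : {rmorphism B -> P}) (I J : B -> Prop) :
  is_ideal I -> is_ideal J ->
  forall x, ext f (idl_add I J) x <-> idl_add (ext f I) (ext f J) x.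
Proof.
move=> II JI x; have eI := ext_ideal f I; have eJ := ext_ideal f J.
have sI := idl_add_ideal eI eJ; split.
  apply: ext_min => // _ [a [b [aI [bJ ->]]]]; rewrite rmorphD.
  by apply: (idealD sI); [apply: idl_addl => //|apply: idl_addr => //]; apply: ext_gen.
apply: idl_add_min; first exact: ext_ideal.
  by apply: ext_min => [|a aI]; [apply: ext_ideal|apply: ext_gen; apply: idl_addl].
by apply: ext_min => [|a aI]; [apply: ext_ideal|apply: ext_gen; apply: idl_addr].
Qed.

Definition multiple (R : comPzRingType) (g : R) (x : R) := exists r, x = r * g.
Lemma multiple_ideal (R : comPzRingType) (g : R) : is_ideal (multiple g).
Proof.
split; first by exists 0; rewrite mul0r.
- by move=> x y [a ->] [b ->]; exists (a + b); rewrite mulrDl.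
- by move=> r x [a ->]; exists (r * a); rewrite mulrA.
Qed.
Lemma multiple_refl (R : comPzRingType) (g : R) : multiple g g.
Proof. by exists 1; rewrite mul1r. Qed.
Lemma multiple_min (R : comPzRingType) (K : R -> Prop) g : is_ideal K -> K g ->
  forall x, multiple g x -> K x.
Proof. by move=> KI Kg _ [r ->]; apply: (idealM KI). Qed.

Lemma ideal_same (R : comPzRingType) (I J : R -> Prop) : same_set I J -> is_ideal J -> is_ideal I.
Proof.
move=> h JI; split=> [|x y /h ? /h ?|r x /h ?]; apply/h; first exact: (ideal0 JI).
  exact: (idealD JI).
exact: (idealM JI).
Qed.

Lemma ext_multiple (A B : comPzRingType) (f : {rmorphism A -> B}) (I : A -> Prop) g :
  same_set I (multiple g) -> same_set (ext f I) (multiple (f g)).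
Proof.
move=> h x; split.
  by apply: ext_min => [|a /h [r ->]]; [apply: multiple_ideal|exists (f r); rewrite rmorphM].
apply: multiple_min; [exact: ext_ideal|apply: ext_gen; apply/h; exact: multiple_refl].
Qed.

Lemma ideal_pow_multiple (A : comPzRingType) (I : A -> Prop) g n :
  same_set I (multiple g) -> same_set (ideal_pow I n) (multiple (g ^+ n)).
Proof.
move=> h x; split.
  apply: ext_min; first exact: multiple_ideal.
  move=> _ [s [sI ->]] /=.
  have /choice [r rE] k : exists r, s k = r * g by apply/h.
  exists (\prod_k r k); under eq_bigr do rewrite rE.
  by rewrite big_split /= prodr_const card_ord.
apply: multiple_min; first exact: ext_ideal.
apply: (@ext_gen _ _ id _ (g ^+ n)); exists (fun _ => g).
by rewrite prodr_const card_ord; split=> // k; apply/h; apply: multiple_refl.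
Qed.

Lemma gen_by_ideal (A : comPzRingType) n (g : 'I_n -> A) : is_ideal (gen_by g).
Proof.
split; first by exists (fun _ => 0); rewrite big1 // => k _; rewrite mul0r.
- move=> x y [r ->] [r' ->]; exists (fun k => r k + r' k); rewrite -big_split.
  by apply: eq_bigr => k _; rewrite mulrDl.
- move=> s x [r ->]; exists (fun k => s * r k); rewrite mulr_sumr.
  by apply: eq_bigr => k _; rewrite mulrA.
Qed.

Lemma ext_fin_gen (A B : comPzRingType) (f : {rmorphism A -> B}) (I : A -> Prop) :
  fin_gen I -> fin_gen (ext f I).
Proof.
move=> [n [g h]]; exists n, (fun k => f (g k)) => x; split.
  apply: ext_min => [|a /h [r ->]]; first exact: gen_by_ideal.
  by exists (fun k => f (r k)); rewrite rmorph_sum; apply: eq_bigr => k _; rewrite rmorphM.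
move=> [r ->]; have eI := ext_ideal f I; apply: (ideal_sum eI) => k _; apply: (idealM eI).
apply: ext_gen; apply/h; exists (fun l => (l == k)%:R).
rewrite (bigD1 k) //= eqxx mul1r big1 ?addr0 // => l /negPf ->; exact: mul0r.
Qed.

(** * Preperfectoid towers *)

Section TowerMaps.
Variables (R : nat -> comPzRingType) (t : forall i, {rmorphism R i -> R i.+1}).

Lemma tw_zmod i : zmod_morphism (tw t i).
Proof. by elim: i => [|i IH] x y //=; rewrite IH rmorphB. Qed.
Lemma tw_monoid i : monoid_morphism (tw t i).
Proof.
elim: i => [|i [IH1 IHM]]; first by split.
by split=> [|x y] /=; rewrite ?IH1 ?IHM ?rmorph1 ?rmorphM.
Qed.
HB.instance Definition _ i := GRing.isZmodMorphism.Build (R 0%N) (R i) (tw t i) (tw_zmod i).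
HB.instance Definition _ i := GRing.isMonoidMorphism.Build (R 0%N) (R i) (tw t i) (tw_monoid i).

Lemma tw1_zmod i : zmod_morphism (tw1 t i).
Proof. by elim: i => [|i IH] x y //=; rewrite IH rmorphB. Qed.
Lemma tw1_monoid i : monoid_morphism (tw1 t i).
Proof.
elim: i => [|i [IH1 IHM]]; first by split.
by split=> [|x y] /=; rewrite ?IH1 ?IHM ?rmorph1 ?rmorphM.
Qed.
HB.instance Definition _ i := GRing.isZmodMorphism.Build (R 1%N) (R i.+1) (tw1 t i) (tw1_zmod i).
HB.instance Definition _ i := GRing.isMonoidMorphism.Build (R 1%N) (R i.+1) (tw1 t i) (tw1_monoid i).

Lemma tw1_tw i x : tw1 t i (tw t 1 x) = tw t i.+1 x.
Proof. by elim: i => //= i ->. Qed.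
End TowerMaps.

Section FrobeniusProjection.
Variables (p : nat) (p_pr : prime p) (R : nat -> comPzRingType).
Variables (t : forall i, {rmorphism R i -> R i.+1}) (I0 : R 0%N -> Prop).
Hypothesis I0p : I0 p%:R.

Local Notation K := (I0R t I0).
Let KI i : is_ideal (K i) := ext_ideal (tw t i) I0.
Local Notation F := (Frel p t I0 _).

Lemma I0R_p i : K i p%:R.
Proof. by rewrite -(rmorph_nat (tw t i)); apply: ext_gen. Qed.

Lemma I0R_step i x : K i x -> K i.+1 (t i x).
Proof.
move=> [n [a [r [aI ->]]]]; rewrite rmorph_sum; apply: (ideal_sum (KI i.+1)) => k _.
rewrite rmorphM; apply: (ideal_mulr (KI i.+1)); exact: (@ext_gen _ _ (tw t i.+1)).
Qed.

Lemma FrelD i y x y' x' : Frel p t I0 i y x -> F y' x' -> F (y + y') (x + x').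
Proof.
move=> h h'; rewrite /Frel rmorphD.
apply: (ideal_trans (KI i.+1) (ideal_exprD (KI i.+1) p_pr (I0R_p i.+1) y y')).
exact: (ideal_congrD (KI i.+1)).
Qed.
Lemma FrelM i y x y' x' : Frel p t I0 i y x -> F y' x' -> F (y * y') (x * x').
Proof. by move=> h h'; rewrite /Frel rmorphM exprMn; apply: (ideal_congrM (KI i.+1)). Qed.
Lemma Frel_step i x : F (t i x) (x ^+ p).
Proof. by rewrite /Frel rmorphXn subrr; apply: (ideal0 (KI i.+1)). Qed.
Lemma Frel_congr i y y' x x' : K i.+1 (y - y') -> K i (x - x') -> F y x -> F y' x'.
Proof.
move=> hy hx h; apply: (ideal_trans (KI i.+1) (y := y ^+ p)).
  by apply: (idealBC (KI i.+1)); apply: (ideal_congrX (KI i.+1)).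
apply: (ideal_trans (KI i.+1) h); rewrite -rmorphB; exact: I0R_step.
Qed.
Lemma Frel_pow i y : K i.+1 y -> F y 0.
Proof.
move=> Ky; rewrite /Frel rmorph0 subr0 -(prednK (prime_gt0 p_pr)) exprS.
exact: (ideal_mulr (KI i.+1)).
Qed.
Lemma Frel0 i y : Frel p t I0 i y 0 <-> K i.+1 (y ^+ p).
Proof. by rewrite /Frel rmorph0 subr0. Qed.
Lemma FrelN i y x : Frel p t I0 i y x -> F (- y) (- x).
Proof.
move=> h; rewrite -mulN1r -[- x]mulN1r; apply: FrelM => //.
rewrite /Frel rmorphN1; move: (I0R_p i.+1).
(* For p = 2 the difference of (-1)^p and -1 is 2, which lies in I_0; for odd p it is zero. *)
case: (even_prime p_pr) => [-> h2|podd].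
  by rewrite sqrrN expr1n opprK.
by rewrite -signr_odd podd expr1 subrr => _; apply: (ideal0 (KI i.+1)).
Qed.
Lemma FrelB i y x y' x' : Frel p t I0 i y x -> F y' x' -> F (y - y') (x - x').
Proof. by move=> h /FrelN; apply: FrelD. Qed.
Lemma Frel_sum i (J : Type) (r : seq J) (G : J -> R i.+1) (H : J -> R i) :
  (forall j, F (G j) (H j)) -> F (\sum_(j <- r) G j) (\sum_(j <- r) H j).
Proof.
move=> h; apply: (big_ind2 (fun y x => F y x)) => //; last by move=> *; apply: FrelD.
exact: Frel_pow (ideal0 (KI i.+1)).
Qed.

Hypothesis inj : forall i (x : R i), K i.+1 (t i x) -> K i x.

Lemma Frel_uniq i y y' x x' : K i.+1 (y - y') -> Frel p t I0 i y x -> F y' x' -> K i (x - x').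
Proof.
move=> hy h h'; apply: inj; rewrite rmorphB; apply: (ideal_trans (KI i.+1) _ h').
apply: (ideal_trans (KI i.+1) (idealBC (KI i.+1) h)); exact: (ideal_congrX (KI i.+1)).
Qed.

End FrobeniusProjection.

Section PreperfectoidTower.
Variables (p : nat) (p_pr : prime p) (R : nat -> comPzRingType).
Variables (t : forall i, {rmorphism R i -> R i.+1}) (I0 : R 0%N -> Prop) (I1 : R 1%N -> Prop).
Hypothesis Hpre : preperfectoid p t I0 I1.
Variables (pi : R 0%N) (g1 : R 1%N).
Hypotheses (Hpi : same_set I0 (multiple pi)) (Hg1 : same_set I1 (multiple g1)).

Local Notation K := (I0R t I0).
Let KI i : is_ideal (K i) := ext_ideal (tw t i) I0.
Let I1I i : is_ideal (I1R t I1 i) := ext_ideal (tw1 t i) I1.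

Let I0p : I0 p%:R. Proof. by case: Hpre => -[]. Qed.

Lemma pre_inj i (x : R i) : K i.+1 (t i x) -> K i x.
Proof. by case: Hpre => -[_ [h _]] _; apply: h. Qed.
Lemma pre_proj i (y : R i.+1) : exists x, Frel p t I0 i y x.
Proof. by case: Hpre => -[_ [_ h]] _; apply: h. Qed.
Lemma pre_surj i (x : R i) : exists y, Frel p t I0 i y x.
Proof. by case: Hpre => _ [h _]; apply: h. Qed.
Lemma pre_ker i y : Frel p t I0 i y 0 <-> idl_add (I1R t I1 i) (K i.+1) y.
Proof.
case: Hpre => _ [_ [_ [_ [_ [h _]]]]].
by split=> [/Frel0|] /h; [|move=> ?; apply/Frel0].
Qed.
Lemma I0R_multiple i : same_set (K i) (multiple (tw t i pi)).
Proof. exact: ext_multiple Hpi. Qed.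
Lemma I1R_multiple i : same_set (I1R t I1 i) (multiple (tw1 t i g1)).
Proof. exact: ext_multiple Hg1. Qed.

(** By I_1^p = I_0 R_1 the elements g1^p and t_0(pi) divide each other in R_1, hence so do their
    images at every higher level. *)
Lemma I0R_pillar_pow i : same_set (K i.+1) (multiple (tw1 t i g1 ^+ p)).
Proof.
case: Hpre => _ [_ [_ [_ [h _]]]]; have hp := ideal_pow_multiple p Hg1.
have [/= r er] : multiple (g1 ^+ p) (tw t 1 pi).
  by apply/hp/h/I0R_multiple; apply: multiple_refl.
have [/= r' er'] : multiple (tw t 1 pi) (g1 ^+ p).
  by apply/I0R_multiple/h/hp; apply: multiple_refl.
move=> x; split=> [/I0R_multiple|] [a ->].
  rewrite -tw1_tw -/(tw t 1) /= er rmorphM rmorphXn; exists (a * tw1 t i r).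
  by rewrite mulrA.
apply/I0R_multiple; rewrite -rmorphXn er' -[tw t i.+1 pi]tw1_tw; exists (a * tw1 t i r').
by rewrite rmorphM mulrA.
Qed.

Lemma torP i (x : R i) : tor t I0 x <-> tw t i pi * x = 0.
Proof.
split=> [h|h a /Hpi [r ->]].
  case: Hpre => _ [_ [_ [_ [_ [_ /(_ i) [h' _]]]]]]; apply: h' => //.
  by apply/Hpi; apply: multiple_refl.
by exists 1; rewrite expr1 rmorphM -mulrA h mulr0.
Qed.

Lemma tor_ideal i : is_ideal (tor t I0 (i := i)).
Proof.
split=> [|x y /torP hx /torP hy|r x /torP hx]; apply/torP; rewrite ?mulr0 //.
  by rewrite mulrDr hx hy addr0.
by rewrite mulrCA hx mulr0.
Qed.

(** If x = r pi and pi x = 0, then pi^2 kills r, so r is torsion and x = pi r = 0. This is the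
    injectivity of phi_{I_0,R_i}. *)
Lemma tor_I0R i (x : R i) : tor t I0 x -> K i x -> x = 0.
Proof.
move=> /torP hx /I0R_multiple [r er]; move: hx; rewrite er => hx.
suff /torP h : tor t I0 r by rewrite mulrC.
move=> a /Hpi [b ->]; exists 2; rewrite rmorphM.
transitivity (tw t i b ^+ 2 * (tw t i pi * (r * tw t i pi))); first by ring.
by rewrite hx mulr0.
Qed.

Lemma tor_proj i (y : R i.+1) : tor t I0 y -> exists x, tor t I0 x /\ Frel p t I0 i y x.
Proof.
case: Hpre => _ [_ [_ [_ [_ [_ /(_ i) [_ [G [h1 [_ [_ h4]]]]]]]]]] hy.
by exists (G y); split; [apply: h1|apply: h4].
Qed.
Lemma tor_surj i (x : R i) : tor t I0 x -> exists y, tor t I0 y /\ Frel p t I0 i y x.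
Proof.
case: Hpre => _ [_ [_ [_ [_ [_ /(_ i) [_ [G [_ [_ [h3 h4]]]]]]]]]] /h3 [y [hy <-]].
by exists y; split=> //; apply: h4.
Qed.
(** [G y] and [G 0] are torsion and lie in I_0 R_i, so both vanish by [tor_I0R]; then [G] is
    injective on torsion. *)
Lemma tor_Frel0 i (y : R i.+1) : tor t I0 y -> Frel p t I0 i y 0 -> y = 0.
Proof.
case: Hpre => _ [_ [_ [_ [_ [_ /(_ i) [_ [G [h1 [h2 [_ h4]]]]]]]]]] hy h0.
have t0 : tor t I0 (0 : R i.+1) by apply: (ideal0 (tor_ideal _)).
have G0 z : tor t I0 z -> Frel p t I0 i z 0 -> G z = 0.
  move=> hz hz0; apply: tor_I0R; first exact: h1.
  have := Frel_uniq pre_inj (y := z) (y' := z) _ (h4 _ hz) hz0; rewrite subr0; apply.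
  by rewrite subrr; apply: (ideal0 (KI _)).
apply: h2 => //; rewrite !G0 //.
by apply: Frel_pow => //; apply: (ideal0 (KI _)).
Qed.

(** * Generators of the pillars and division in the tilt *)

Variable f : forall m, R m.
Hypotheses (f0 : f 0 = pi) (f1 : f 1 = g1).
Hypothesis fS : forall m, Frel p t I0 m.+1 (f m.+2) (f m.+1).

Definition gen_mod m : R m -> Prop := idl_add (multiple (f m)) (K m).
Lemma gen_mod_ideal m : is_ideal (@gen_mod m).
Proof. exact: idl_add_ideal (multiple_ideal _) (KI m). Qed.

(** Level 0 is separate: g1^p and t_0(pi) both lie in I_0 R_1. *)
Lemma fF m : Frel p t I0 m (f m.+1) (f m).
Proof.
case: m => [|m] //; rewrite f0 f1; apply: (idealB (KI 1)).
  by apply/I0R_pillar_pow; apply: multiple_refl.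
by apply/I0R_multiple; apply: multiple_refl.
Qed.

(** The congruence of t(f_(m+1)) with f_(m+2)^p carries multiples of f_(m+1) to multiples of
    f_(m+2), modulo I_0. *)
Lemma gen_mod_pillar m : gen_mod (tw1 t m g1).
Proof.
elim: m => [|m [_ [k [[r ->] [hk e]]]]].
  by rewrite -f1; apply: idl_addl (KI 1) (multiple_refl _).
rewrite /= e rmorphD rmorphM; have LI := gen_mod_ideal m.+2.
apply: (idealD LI); last by apply: idl_addr (multiple_ideal _) _; apply: I0R_step.
apply: (idealM LI); apply/(ideal_congr LI (y := f m.+2 ^+ p)).
  apply: (idealBC LI); apply: idl_addr (multiple_ideal _) _; exact: fS.
rewrite -(prednK (prime_gt0 p_pr)) exprSr; apply: idl_addl => //.
by exists (f m.+2 ^+ p.-1).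
Qed.

Lemma ker_gen_mod m (y : R m.+1) : Frel p t I0 m y 0 -> gen_mod y.
Proof.
move/pre_ker; have LI := gen_mod_ideal m.+1; apply: idl_add_min => // x.
  move/I1R_multiple; apply: multiple_min => //; exact: gen_mod_pillar.
exact: idl_addr (multiple_ideal _).
Qed.

(** Lift the cofactor of f_m in x along F_m; the resulting multiple of f_(m+1) differs from y by an
    element of ker F_m, where [ker_gen_mod] applies. *)
Lemma gen_mod_lift m (y : R m.+1) (x : R m) : Frel p t I0 m y x -> gen_mod x -> gen_mod y.
Proof.
move=> h [_ [k [[r ->] [hk e]]]]; have LI := gen_mod_ideal m.+1.
have [r' hr] := pre_surj r; apply/(ideal_congr LI (y := r' * f m.+1)).
  apply: ker_gen_mod; have h' := FrelB p_pr I0p h (FrelM hr (fF m)).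
  apply: Frel_congr h' => //; first by rewrite subrr; apply: (ideal0 (KI _)).
  by rewrite subr0 e addrAC subrr add0r.
by apply: idl_addl => //; exists r'.
Qed.

(** By induction F_m sends the torsion element f_(m+1) y to f_m x = 0, and F_m is injective on
    torsion. *)
Lemma tor_gen m (x : R m) : tor t I0 x -> f m * x = 0.
Proof.
elim: m x => [|m IH] y; first by rewrite f0 => /torP.
move=> hy; have [x [hx hyx]] := tor_proj hy.
apply: tor_Frel0; first exact: (idealM (tor_ideal _)).
by rewrite -(IH _ hx); apply: FrelM => //; apply: fF.
Qed.

(** A cofactor of f_(m+1) is thus determined up to ker F_m and torsion. Since g lies in (f_(m+1)) +
    I_0 R_(m+1), g d = y g^p for some y. Then y g^(p-1) is in ker F_m as p > 1, and d - y g^(p-1) is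
    killed by g, hence by pi. *)
Lemma gen_annihilator m (d : R m.+1) : K m.+1 (f m.+1 * d) ->
  exists e z, d = e + z /\ Frel p t I0 m e 0 /\ tor t I0 z.
Proof.
move=> h; set g := tw1 t m g1.
have /I0R_pillar_pow [y hy] : K m.+1 (g * d).
  have [_ [k [[r ->] [hk e]]]] := gen_mod_pillar m.
  rewrite /g e mulrDl -mulrA; apply: (idealD (KI _)); first exact: (idealM (KI _)).
  exact: (ideal_mulr (KI _)).
exists (y * g ^+ p.-1), (d - y * g ^+ p.-1); split; first by rewrite addrC subrK.
split.
  apply/pre_ker; apply: idl_addl => //; apply/I1R_multiple.
  have := prime_gt1 p_pr; case: (p) => [|[|q]] //= _.
  by exists (y * g ^+ q); rewrite exprSr mulrA.
apply/torP; have /I0R_pillar_pow [w ->] : K m.+1 (tw t m.+1 pi).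
  by apply/I0R_multiple; apply: multiple_refl.
rewrite -/g; have e : g ^+ p = g ^+ p.-1 * g by rewrite -exprSr prednK ?prime_gt0.
suff e' : g * (d - y * g ^+ p.-1) = 0 by rewrite e -!mulrA e' !mulr0.
by rewrite mulrBr hy e; ring.
Qed.

Lemma tilt_divide i (y : forall j, R (j + i)%N) :
  tilt p t I0 y -> gen_mod (y 0%N) ->
  exists b : forall j, R (j + i)%N, tilt p t I0 b /\ forall j, K (j + i) (y j - f (j + i) * b j).
Proof.
move=> yT y0.
have yL j : gen_mod (y j) by elim: j => // j IH; apply: gen_mod_lift (yT j) IH.
have q j : {b | K (j + i) (y j - f (j + i) * b)}.
  by apply: cid; have [_ [k [[r ->] [hk ->]]]] := yL j; exists r; rewrite [f _ * r]mulrC addrAC subrr add0r.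
pose b' j := sval (q j); have b'P j : K (j + i) (y j - f (j + i) * b' j) := svalP (q j).
(* Applying F to b'_(j+1) removes the part of its ambiguity that lies in ker F. *)
pose b j : R (j + i)%N := sval (cid (pre_proj (b' j.+1 : R (j + i).+1))).
have bP j : Frel p t I0 (j + i) (b' j.+1) (b j) := svalP (cid (pre_proj (b' j.+1 : R (j + i).+1))).
have yb j : K (j + i) (y j - f (j + i) * b j).
  by apply: (Frel_uniq pre_inj (b'P j.+1) (yT j)); apply: FrelM => //; apply: fF.
(* By [gen_annihilator], b_(j+1) and b'_(j+1) differ by an element of ker F and a torsion element,
   so F(b_(j+1)) is b_j up to torsion. *)
have qt j : {z : R (j + i)%N | tor t I0 z /\ Frel p t I0 (j + i) (b j.+1) (b j + z)}.
  apply: cid; have hd : K (j + i).+1 (f (j + i).+1 * (b j.+1 - b' j.+1)).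
    rewrite mulrBr; apply: (ideal_trans (KI _) _ (b'P j.+1)).
    by apply: (idealBC (KI _)); apply: yb.
  have [e [z [ez [e0 hz]]]] := gen_annihilator hd.
  have [x [hx hzx]] := tor_proj hz; exists x; split=> //.
  have -> : b j.+1 = b' j.+1 + (e + z) by rewrite -ez addrC subrK.
  by rewrite -[x]add0r; apply: (FrelD p_pr I0p (bP j)); apply: (FrelD p_pr I0p).
pose z j := sval (qt j).
have zP j : tor t I0 (z j) := (svalP (qt j)).1.
have zF j : Frel p t I0 (j + i) (b j.+1) (b j + z j) := (svalP (qt j)).2.
pose T j := {s : R (j + i)%N | tor t I0 s}.
(* The torsion bijections solve F(s_(j+1)) = s_j - z_j from s_0 = 0. Then b_j + s_j is compatible,
   and f_(i+j) kills s_j, so the products do not change. *)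
have step j (s : T j) : {s' : T j.+1 | Frel p t I0 (j + i) (sval s') (sval s - z j)}.
  apply: cid; have [s' [hs' h]] := tor_surj (idealB (tor_ideal _) (svalP s) (zP j)).
  by exists (exist _ s' hs').
pose s0 : T 0%N := exist _ 0 (ideal0 (tor_ideal i)).
pose s : forall j, T j := nat_rect T s0 (fun j s => sval (step j s)).
exists (fun j => b j + sval (s j)); split=> j.
  have h : Frel p t I0 (j + i) (sval (s j.+1)) (sval (s j) - z j) := svalP (step j (s j)).
  by have := FrelD p_pr I0p (zF j) h; rewrite -addrA [z j + _]addrC subrK.
by rewrite mulrDr (tor_gen (svalP (s j))) addr0.
Qed.

Variable J : forall i, R i -> Prop.
Hypothesis HJ : pillars p t I0 I1 J.

Lemma pillar_ideal i : is_ideal (@J i).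
Proof.
case: HJ => h0 [h1 [h2 _]]; case: i => [|[|i]].
- apply: ideal_same h0 _; apply: ideal_same Hpi _; exact: multiple_ideal.
- apply: ideal_same h1 _; apply: ideal_same Hg1 _; exact: multiple_ideal.
- by have [[n [g h]] _] := h2 i.+2 isT; apply: ideal_same h (gen_by_ideal g).
Qed.

Lemma pillar_gen_mod m (x : R m) : idl_add (@J m) (K m) x -> gen_mod x.
Proof.
case: HJ => h0 [_ [_ [h3 _]]]; elim: m x => [|m IH] x.
  have LI := gen_mod_ideal 0; apply: idl_add_min => // y; last exact: idl_addr (multiple_ideal _).
  by move=> /h0 /Hpi hy; apply: idl_addl => //; rewrite f0.
by move/h3 => [x' [/IH hx h]]; apply: gen_mod_lift h hx.
Qed.

Let PI m : is_ideal (idl_add (@J m) (K m)) := idl_add_ideal (pillar_ideal m) (KI m).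

(** If y in the next pillar lies over the image of g1, then y^p is congruent modulo I_0 to the next
    image of g1. *)
Lemma pillar_contains_first m : idl_add (@J m.+1) (K m.+1) (tw1 t m g1).
Proof.
case: HJ => _ [h1 [_ [_ h4]]]; elim: m => [|m IH].
  by apply: idl_addl => //; apply/h1/Hg1; apply: multiple_refl.
have [y [hy hF]] := h4 _ _ IH.
apply/(ideal_congr (PI _) (y := y ^+ p)).
  by apply: (idealBC (PI _)); apply: idl_addr (pillar_ideal _) _; apply: hF.
by rewrite -(prednK (prime_gt0 p_pr)) exprS; apply: (ideal_mulr (PI _)).
Qed.

(** An element of the next pillar over f_m differs from f_(m+1) by an element of ker F_m, which lies
    in that pillar by [pillar_contains_first]. *)
Lemma pillar_contains_gen m : idl_add (@J m) (K m) (f m).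
Proof.
case: HJ => h0 [h1 [_ [_ h4]]]; elim: m => [|m IH].
  by apply: idl_addl => //; apply/h0/Hpi; rewrite f0; apply: multiple_refl.
have [y [hy hF]] := h4 _ _ IH.
apply/(ideal_congr (PI _) (y := y)) => //.
have /pre_ker : Frel p t I0 m (f m.+1 - y) 0 by rewrite -(subrr (f m)); apply: (FrelB p_pr I0p (fF m) hF).
apply: idl_add_min => // x; last exact: idl_addr (pillar_ideal _).
by move/I1R_multiple; apply: multiple_min => //; apply: pillar_contains_first.
Qed.
End PreperfectoidTower.

(** * Base change of a tower *)

Section BaseChange.
Variables (p : nat) (p_pr : prime p) (R : nat -> comPzRingType).
Variables (t : forall i, {rmorphism R i -> R i.+1}) (I0 : R 0%N -> Prop) (I1 : R 1%N -> Prop).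
Hypothesis Hpre : preperfectoid p t I0 I1.
Variables (S0 : comPzRingType) (phi : {rmorphism R 0%N -> S0}).
Hypothesis Het : weakly_etale phi.
Variables (S : nat -> comPzRingType) (u : forall i, {rmorphism S i -> S i.+1}).
Variables (s : forall i, {rmorphism R i -> S i}) (sg : forall i, {rmorphism S0 -> S i}).
Hypothesis Hpo : forall i, is_pushout (tw t i) (phi : R 0%N -> S0) (s i : R i -> S i) (sg i : S0 -> S i).
Hypothesis Hu1 : forall i (x : R i), u i (s i x) = s i.+1 (t i x).
Hypothesis Hu2 : forall i (x : S0), u i (sg i x) = sg i.+1 x.
Variables (pi : R 0%N) (g1 : R 1%N).
Hypotheses (Hpi : same_set I0 (multiple pi)) (Hg1 : same_set I1 (multiple g1)).

Local Notation I0' := (ext (s 0%N) I0).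
Local Notation I1' := (ext (s 1%N) I1).
Local Notation K := (I0R t I0).
Local Notation K' := (I0R u I0').
Local Notation spanS i := (gen_span (s i) (sg i)).
Let KI i : is_ideal (K i) := ext_ideal (tw t i) I0.
Let KI' i : is_ideal (K' i) := ext_ideal (tw u i) I0'.
Let I1I i : is_ideal (I1R t I1 i) := ext_ideal (tw1 t i) I1.
Let I0p : I0 p%:R. Proof. by case: Hpre => -[]. Qed.
Let Hpo' i : is_pushout (tw t i : {rmorphism R 0%N -> R i}) phi (s i) (sg i) := Hpo i.

Lemma base_tw i x : s i (tw t i x) = tw u i (s 0%N x).
Proof. by elim: i => //= i <-; rewrite Hu1. Qed.
Lemma base_tw1 i x : s i.+1 (tw1 t i x) = tw1 u i (s 1%N x).
Proof. by elim: i => //= i <-; rewrite Hu1. Qed.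

Lemma base_I0R i z : K' i z <-> ext (s i) (K i) z.
Proof.
have EI := ext_ideal (s i) (K i); split; apply: ext_min => //.
  move=> _ [n [a [r [aI ->]]]]; rewrite rmorph_sum; apply: (ideal_sum EI) => k _.
  rewrite rmorphM /= -base_tw; apply: (ideal_mulr EI); apply: ext_gen; exact: (@ext_gen _ _ (tw t i)).
move=> _ [n [a [r [aI ->]]]]; rewrite rmorph_sum; apply: (ideal_sum (KI' i)) => k _.
rewrite rmorphM /= base_tw; apply: (ideal_mulr (KI' i)).
by apply: (@ext_gen _ _ (tw u i)); apply: ext_gen.
Qed.

Lemma base_I1R i z : I1R u I1' i z <-> ext (s i.+1) (I1R t I1 i) z.
Proof.
have EI := ext_ideal (s i.+1) (I1R t I1 i); have EI' := ext_ideal (tw1 u i) I1'.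
split; apply: ext_min => //.
  move=> _ [n [a [r [aI ->]]]]; rewrite rmorph_sum; apply: (ideal_sum EI) => k _.
  rewrite rmorphM /= -base_tw1; apply: (ideal_mulr EI); apply: ext_gen; exact: (@ext_gen _ _ (tw1 t i)).
move=> _ [n [a [r [aI ->]]]]; rewrite rmorph_sum; apply: (ideal_sum EI') => k _.
rewrite rmorphM /= base_tw1; apply: (ideal_mulr EI').
by apply: (@ext_gen _ _ (tw1 u i)); apply: ext_gen.
Qed.

Lemma base_I0p : I0' p%:R.
Proof. by rewrite -(rmorph_nat (s 0%N)); apply: ext_gen. Qed.

Let TI (A : comPzRingType) : is_ideal (fun _ : A => True). Proof. by split. Qed.

(** By flatness the preimage of I_0 R_(i+1) under t_i, which is I_0 R_i, extends to the
    corresponding preimage in [S i]. *)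
Lemma base_inj i (z : S i) : K' i.+1 (u i z) -> K' i z.
Proof.
move/base_I0R => h; apply/base_I0R.
have := @pushout_preimage _ _ _ _ _ _ (tw t i) (tw t i.+1) phi (s i) (sg i) (s i.+1) (sg i.+1)
  (t i) (u i) (fun _ => True) (K i.+1) z (Hpo i) (Hpo i.+1) Het.1.
move=> h'; apply: ext_sub (h' _ _ (TI _) (KI _) (ext_total (Hpo' i) z) h).
- by move=> b [_]; apply: pre_inj Hpre _ _.
- by move=> a b; apply: (rmorphM (t i)).
- by move=> b c; apply: (etrans (rmorphM (u i) _ _)); rewrite Hu1 Hu2.
Qed.

Lemma base_Frel i y x : Frel p t I0 i y x -> Frel p u I0' i (s i.+1 y) (s i x).
Proof.
move=> h; apply/base_I0R; rewrite Hu1 -rmorphXn -rmorphB; exact: ext_gen.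
Qed.

Lemma base_Frel_gen i y x b : Frel p t I0 i y x ->
  Frel p u I0' i (s i.+1 y * sg i.+1 b) (s i x * sg i (b ^+ p)).
Proof.
move=> h; apply: FrelM; first exact: base_Frel.
by rewrite /Frel Hu2 rmorphXn subrr; apply: (ideal0 (KI' _)).
Qed.

(** General [L] and [L'] let one induction on pure tensors serve the whole ring, the torsion and the
    pillars; [base_surj] has the same form. *)
Lemma base_lift i (L : R i.+1 -> Prop) (L' : R i -> Prop) :
  (forall y, L y -> exists x, L' x /\ Frel p t I0 i y x) ->
  forall z, spanS i.+1 L z -> exists z', spanS i L' z' /\ Frel p u I0' i z z'.
Proof.
move=> h z; elim=> [y b /h [x [hx hF]]||z1 z2 _ [w1 [h1 F1]] _ [w2 [h2 F2]]].
- by exists (s i x * sg i (b ^+ p)); split; [apply: GenSpan|apply: base_Frel_gen].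
- exists 0; split; first exact: GenSpan0.
  by apply: (Frel_pow p_pr); apply: (ideal0 (KI' _)).
- by exists (w1 + w2); split; [apply: GenSpanD|apply: FrelD base_I0p _ _ _ _ _ _ _].
Qed.

(** Write b through phi(a) e^p and multiples of p: x (x) phi(a) e^p = a x (x) e^p is the image of y
    (x) e for any y in [L] over a x, and multiples of p vanish modulo I_0. *)
Lemma base_surj i (L : R i.+1 -> Prop) (L' : R i -> Prop) : is_ideal L' ->
  (forall x, L' x -> exists y, L y /\ Frel p t I0 i y x) ->
  forall z', spanS i L' z' -> exists z, spanS i.+1 L z /\ Frel p u I0' i z z'.
Proof.
move=> LI h z; elim=> [x b||z1 z2 _ [w1 [h1 F1]] _ [w2 [h2 F2]]].
- elim: (rel_frob_surj Het p_pr b) x => [a e|v|b1 b2 _ h1 _ h2] x hx.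
  + have [y [hy hF]] := h _ (idealM LI (tw t i a) hx).
    exists (s i.+1 y * sg i.+1 e); split; first exact: GenSpan.
    have := base_Frel_gen e hF; congr (Frel _ _ _ _ _ _).
    by rewrite !rmorphM (Hpo i).1; ring.
  + exists 0; split; first exact: GenSpan0.
    rewrite /Frel expr0n gtn_eqF ?prime_gt0 // sub0r; apply: (idealN (KI' _)).
    apply: I0R_step; apply: (idealM (KI' _)); rewrite rmorphM rmorph_nat.
    by apply: (ideal_mulr (KI' _)); apply: I0R_p base_I0p _.
  + have [w1 [k1 F1]] := h1 x hx; have [w2 [k2 F2]] := h2 x hx.
    exists (w1 + w2); split; first exact: GenSpanD.
    by rewrite rmorphD mulrDr; apply: FrelD base_I0p _ _ _ _ _ _ _.
- exists 0; split; first exact: GenSpan0.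
  by apply: (Frel_pow p_pr); apply: (ideal0 (KI' _)).
- by exists (w1 + w2); split; [apply: GenSpanD|apply: FrelD base_I0p _ _ _ _ _ _ _].
Qed.

Lemma base_total i (z : S i) : spanS i (fun _ => True) z.
Proof. apply: (ext_gen_span (Hpo' i)) => //; exact: ext_total (Hpo' i) z. Qed.

Section Kernel.
Variable i : nat.
Local Notation KK := (idl_add (I1R t I1 i) (K i.+1)).

(* [x (x) b |-> F(x) (x) b^p] has kernel [KK]: its inverse modulo [KK] is
   [z (x) b |-> sum_k F^-1(a_k z) (x) e_k] for [b = sum_k phi(a_k) e_k^p], which is
   well defined because the relative Frobenius of [phi] is injective. *)
Lemma base_kernel (y : S i.+1) : Frel p u I0' i y 0 -> ext (s i.+1) KK y.
Proof.
move=> hy; have EI := ext_ideal (s i.+1) KK.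
have [Q [pr [prD pr0]]] := zmod_quotient (ideal0 EI) (idealD EI) (idealN EI).
have prN x : pr (- x) = - pr x.
  by apply: (@addrI _ (pr x)); rewrite -prD !subrr; apply/pr0; apply: (ideal0 EI).
(* [xi] is a set-theoretic section of F_i; in the quotient by the extension of [KK] = ker F_i, any
   preimage gives the same class. *)
have [xi xiP] := choice (pre_surj Hpre (i := i)).
pose ga z b := pr (s i.+1 (xi z) * sg i.+1 b).
have gaE x z b : Frel p t I0 i x z -> ga z b = pr (s i.+1 x * sg i.+1 b).
  move=> h; apply/eqP; rewrite -subr_eq0 -prN -prD -mulrBl -rmorphB; apply/eqP/pr0.
  apply: (ideal_mulr EI); apply: ext_gen; apply/(pre_ker Hpre).
  by rewrite -(subrr z); apply: FrelB.
have ga1 : biadditive ga.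
  split=> [z b b'|z z' b]; first by rewrite /ga -prD rmorphD mulrDr.
  by rewrite (gaE (xi z + xi z')) ?rmorphD ?mulrDl ?prD //; apply: FrelD.
have gaK z b : K i z -> ga z b = 0.
  move=> h; rewrite (gaE 0); last first.
    rewrite /Frel expr0n gtn_eqF ?prime_gt0 // sub0r; apply: (idealN (KI _)).
    exact: I0R_step.
  by rewrite rmorph0 mul0r; apply/pr0; apply: (ideal0 EI).
(* F_i sends the image of r in R_(i+1) to that of r^p in R_i, so the scalar r^p below becomes r
   above. *)
have gaM r z b : ga (tw t i (r ^+ p) * z) b = ga z (phi r * b).
  rewrite (gaE (tw t i.+1 r * xi z)).
    by rewrite /ga !rmorphM (Hpo i.+1).1; congr pr; ring.
  by apply: FrelM => //; rewrite rmorphXn; apply: Frel_step.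
(* For fixed z this map respects the relations of the Frobenius twist, so it can be evaluated at
   [kap b]. *)
pose W z a b := ga (tw t i a * z) b.
have WP z : dbalanced (ring_rel (frob_rel phi p I0)) (W z).
  apply/ring_relP; split.
    by split=> [a b b'|a a' b]; rewrite /W ?ga1.1 // rmorphD mulrDl ga1.2.
  move=> x w; rewrite /W => -[[r [-> ->]]|[xI ->]] a b; first by rewrite rmorphM -mulrA gaM.
  rewrite mul0r (biadd0r ga1) gaK // rmorphM -mulrA; apply: (ideal_mulr (KI _)).
  exact: (@ext_gen _ _ (tw t i)).
have [kap [kapD kapM kapX kapI]] := rel_frob_inverse Het p_pr I0p.
pose gh z b : Q := wev (W z) (kap b).
have gh1 : biadditive gh.
  split=> [z b b'|z z' b]; first by rewrite /gh kapD wevD.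
  rewrite /gh /wev /wsum -big_split; apply: eq_bigr => k _.
  by rewrite /W mulrDr ga1.2.
have ghM a z b : gh (tw t i a * z) b = gh z (phi a * b).
  rewrite /gh kapM; have [n [m [c ->]]] := tensor_ord (kap b).
  rewrite mulr_sumr !wev_sum //; apply: eq_bigr => k _.
  by rewrite /tenl tenM mul1r !wev_ten // /W rmorphM; congr (ga _ _); ring.
have ghK z b : K i z -> gh z b = 0.
  move=> h; rewrite /gh /wev /wsum big1 // => k _; apply: gaK; exact: (idealM (KI _)).
have ghX z b : gh z (b ^+ p) = ga z b.
  by rewrite /gh kapX wev_ten // /W rmorph1 mul1r.
have [n [x [b [_ ey]]]] := gen_span_ord (base_total y).
have [z zP] := choice (fun k => pre_proj Hpre (x k)).
(* This element represents F_i(y), computed termwise; the sum of [gh] over its terms is the class of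
   y modulo [KK]. *)
have : ext (s i) (K i) (\sum_k s i (z k) * sg i (b k ^+ p)).
  apply/base_I0R; rewrite -[X in K' i X]subr0.
  apply: (Frel_uniq base_inj (y := y) (y' := y) _ _ hy); first by rewrite subrr; apply: (ideal0 (KI' _)).
  by rewrite ey; apply: (Frel_sum p_pr base_I0p) => k; apply: base_Frel_gen.
move/(pushout_zero_mod (Hpo' i) (KI i) gh1 ghM ghK); under eq_bigr do rewrite ghX (gaE _ _ _ (zP _)).
have prz : pr 0 = 0 by apply/pr0; apply: (ideal0 EI).
by rewrite -(big_morph pr prD prz) -ey => /pr0.
Qed.
End Kernel.

(** A single power pi^n kills z, and by flatness the kernel of multiplication by pi^n on [S i] is
    extended from [R i]. *)
Lemma base_tor_span i z : tor u I0' z -> ext (s i) (tor t I0 (i := i)) z.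
Proof.
move=> hz; have [|n hn] := hz (s 0%N pi).
  by apply: ext_gen; apply/Hpi; apply: multiple_refl.
pose m := tw t i pi ^+ n.
have mN : zmod_morphism (fun x : R i => m * x) by move=> x y; rewrite mulrBr.
have mN' : zmod_morphism (fun x : S i => s i m * x) by move=> x y; rewrite mulrBr.
pose h : {additive R i -> R i} := HB.pack (fun x : R i => m * x)
  (GRing.isZmodMorphism.Build _ _ _ mN).
pose h' : {additive S i -> S i} := HB.pack (fun x : S i => s i m * x)
  (GRing.isZmodMorphism.Build _ _ _ mN').
have ZI : is_ideal (fun x : R i => x = 0).
  by split=> [//|x y -> ->|r x ->]; rewrite ?addr0 ?mulr0.
have := @pushout_preimage _ _ _ _ _ _ (tw t i) (tw t i) phi (s i) (sg i) (s i) (sg i)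
  h h' (fun _ => True) (fun x => x = 0) z (Hpo i) (Hpo i) Het.1.
move=> H; apply: ext_sub (H _ _ (TI _) ZI (ext_total (Hpo' i) z) _).
- move=> x [_ /= hx] a /Hpi [r ->]; exists n.
  by rewrite rmorphM exprMn -mulrA hx mulr0.
- by move=> a b /=; rewrite mulrCA.
- by move=> b c /=; rewrite rmorphM mulrA.
- rewrite /= /m rmorphXn base_tw hn; exact: (ideal0 (ext_ideal _ _)).
Qed.

Lemma base_span_tor i z : ext (s i) (tor t I0 (i := i)) z -> tw u i (s 0%N pi) * z = 0.
Proof.
move=> [n [a [r [aI ->]]]]; rewrite mulr_sumr big1 // => k _.
by rewrite mulrA -base_tw -rmorphM (torP Hpre Hpi _).1 // rmorph0 mul0r.
Qed.

Lemma base_multiple : same_set I0' (multiple (s 0%N pi)).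
Proof. exact: ext_multiple. Qed.

Lemma base_torP i z : tor u I0' z <-> ext (s i) (tor t I0 (i := i)) z.
Proof.
split; first exact: base_tor_span.
move/base_span_tor => h a /base_multiple [r ->]; exists 1.
by rewrite expr1 rmorphM -mulrA h mulr0.
Qed.

(** Intersections of ideals commute with flat base change. With [M] = I_0 R_i or ker F_i this
    transfers [tor_I0R] and [tor_Frel0]. *)
Lemma base_tor_inter i (M : R i -> Prop) z : is_ideal M ->
  (forall x, tor t I0 x -> M x -> x = 0) -> tor u I0' z -> ext (s i) M z -> z = 0.
Proof.
move=> MI hM /base_torP hz hz'.
have := @pushout_preimage _ _ _ _ _ _ (tw t i) (tw t i) phi (s i) (sg i) (s i) (sg i)
  idfun idfun (tor t I0 (i := i)) M z (Hpo i) (Hpo i) Het.1 (fun _ _ => erefl) (fun _ _ => erefl)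
  (tor_ideal Hpre Hpi i) MI hz hz'.
move=> [n [a [r [aI ->]]]]; rewrite big1 // => k _.
by have [h1 h2] := aI k; rewrite (hM _ h1 h2) rmorph0 mul0r.
Qed.

Lemma base_tor_ideal i : is_ideal (tor u I0' (i := i)).
Proof. apply: ideal_same (fun z => base_torP z) _; exact: ext_ideal. Qed.

Lemma base_preperfectoid : preperfectoid p u I0' I1'.
Proof.
have torI i := tor_ideal Hpre Hpi i.
split; first split; first exact: base_I0p.
  split; first exact: base_inj.
  move=> i y; have [|x [_ h]] := base_lift (i := i) (L := fun _ => True) (L' := fun _ => True) _ (base_total y).
    by move=> x _; have [x' h] := pre_proj Hpre x; exists x'.
  by exists x.
split.
  move=> i x; have [||y [_ h]] := base_surj (i := i) (L := fun _ => True) (L' := fun _ => True) _ _ (base_total x).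
  - exact: TI.
  - by move=> z _; have [y h] := pre_surj Hpre z; exists y.
  - by exists y.
split; first by exists (s 0%N pi); apply: base_multiple.
have Hg1' : same_set I1' (multiple (s 1%N g1)) by apply: ext_multiple.
split; first by exists (s 1%N g1).
split.
  move=> x; have h : same_set (K' 1) (multiple (s 1%N (g1 ^+ p))).
    move=> z; rewrite base_I0R; apply: ext_multiple.
    exact: (I0R_pillar_pow Hpre Hpi Hg1 (i := 0)).
  by rewrite (ideal_pow_multiple p Hg1' x) (h x) rmorphXn.
have sum_eq i z : idl_add (I1R u I1' i) (K' i.+1) z <-> ext (s i.+1) (idl_add (I1R t I1 i) (K i.+1)) z.
  rewrite ext_idl_add //; split=> -[a [b [ha [hb ->]]]]; exists a, b.
    by split; [apply/base_I1R|split=> //; apply/base_I0R].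
  by split; [apply/base_I1R|split=> //; apply/base_I0R].
have ker i (y : S i.+1) : K' i.+1 (y ^+ p) <-> idl_add (I1R u I1' i) (K' i.+1) y.
  rewrite -(Frel0 p u I0' y); split; first by move/base_kernel/sum_eq.
  move/sum_eq => [n [a [r [aI ->]]]].
  apply/Frel0/(ideal_congr (KI' _) (ideal_expr_sum (KI' _) p_pr (I0R_p u base_I0p i.+1) _ _)).
  apply: (ideal_sum (KI' _)) => k _; rewrite exprMn; apply: (ideal_mulr (KI' _)); apply/Frel0.
  by rewrite -(rmorph0 (s i)); apply: base_Frel; apply/(pre_ker Hpre).
split; first exact: ker.
have torK i (z : S i) : tor u I0' z -> K' i z -> z = 0.
  by move=> hz /base_I0R; apply: base_tor_inter => // x; apply: (tor_I0R Hpre Hpi).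
have tor0 i (y : S i.+1) : tor u I0' y -> Frel p u I0' i y 0 -> y = 0.
  move=> hy /base_kernel; apply: base_tor_inter hy; first exact: idl_add_ideal.
  by move=> x hx /(pre_ker Hpre); apply: (tor_Frel0 p_pr Hpre Hpi).
move=> i; split.
  move=> a x /base_multiple [r ->] /base_torP/base_span_tor h.
  by rewrite rmorphM -mulrA h mulr0.
(* The default 0 off the torsion makes the statement total, so that [choice] gives a function on all
   of [S i.+1]. *)
have torF (y : S i.+1) : exists z, tor u I0' y -> tor u I0' z /\ Frel p u I0' i y z.
  have [hy|] := pselect (tor u I0' y); last by exists 0.
  have /base_torP/(ext_gen_span (Hpo' _) (torI _)) hy' := hy.
  have [|z [hz h]] := base_lift (L' := tor t I0 (i := i)) _ hy'; first exact: (tor_proj Hpre).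
  by exists z => _; split=> //; apply/base_torP; apply: gen_span_ext hz.
have [G GP] := choice torF; exists G; split; last split; last split.
- by move=> y /GP [].
- move=> y y' hy hy' e; apply/eqP; rewrite -subr_eq0; apply/eqP; apply: tor0.
    exact: (idealB (base_tor_ideal _)).
  by have := FrelB p_pr base_I0p (GP _ hy).2 (GP _ hy').2; rewrite e subrr.
- move=> x hx; have /base_torP/(ext_gen_span (Hpo' _) (torI _)) hx' := hx.
  have [|y [/gen_span_ext/base_torP hy h]] := base_surj (L := tor t I0 (i := i.+1)) (torI i) _ hx'.
    exact: (tor_surj Hpre).
  (* [G y] and x are torsion and both represent F_i(y), so their difference is a torsion element of
     I_0 S_i. *)
  exists y; split=> //; apply/eqP; rewrite -subr_eq0; apply/eqP; apply: torK.
    by apply: (idealB (base_tor_ideal _)) => //; have [] := GP _ hy.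
  apply: (Frel_uniq base_inj (y := y) (y' := y) _ (GP _ hy).2 h).
  by rewrite subrr; apply: (ideal0 (KI' _)).
- by move=> y /GP [].
Qed.

Lemma base_pillars J : pillars p t I0 I1 J -> pillars p u I0' I1' (fun i => ext (s i) (@J i)).
Proof.
move=> HJ; have JI := pillar_ideal Hpi Hg1 HJ; have [h0 [h1 [h2 [h3 h4]]]] := HJ.
(* As a span of pure tensors, the extended pillar modulo I_0 is within reach of [base_lift] and
   [base_surj]. *)
have PE i z : idl_add (ext (s i) (J i)) (K' i) z <-> spanS i (idl_add (J i) (K i)) z.
  split.
    move=> [a [b [ha [/base_I0R hb ->]]]]; apply: (ext_gen_span (Hpo' i)).
      exact: idl_add_ideal.
    by apply/ext_idl_add => //; exists a, b.
  move/gen_span_ext => /(ext_idl_add (s i) (JI i) (KI i) z).1 [a [b [ha [/base_I0R hb ->]]]].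
  by exists a, b.
split; first by move=> x; split; apply: ext_sub => y /h0.
split; first by move=> x; split; apply: ext_sub => y /h1.
split.
  move=> i /h2 [hf hK]; split; first exact: ext_fin_gen.
  by move=> x /base_I0R; apply: ext_sub.
split=> i.
  by move=> y /PE hy; have [x [/PE hx hF]] := base_lift (h3 i) hy; exists x.
move=> x /PE hx; have [y [/PE hy hF]] := base_surj (idl_add_ideal (JI i) (KI i)) (h4 i) hx.
by exists y.
Qed.

End BaseChange.

(** * The base-changed tower, its pillars and their small tilts *)

Theorem theorem3p27 (p : nat) (hp : prime p)
  (R : nat -> comPzRingType) (t : forall i, {rmorphism R i -> R i.+1})
  (I0 : R 0%N -> Prop) (I1 : R 1%N -> Prop)
  (Hpre : preperfectoid p t I0 I1)
  (S0 : comPzRingType) (phi : {rmorphism R 0%N -> S0}) (Het : weakly_etale phi)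
  (S : nat -> comPzRingType) (u : forall i, {rmorphism S i -> S i.+1})
  (s : forall i, {rmorphism R i -> S i}) (sg : forall i, {rmorphism S0 -> S i})
  (Hpo : forall i, is_pushout (tw t i) (phi : R 0%N -> S0) (s i : R i -> S i) (sg i : S0 -> S i))
  (Hu1 : forall i (x : R i), u i (s i x) = s i.+1 (t i x))
  (Hu2 : forall i (x : S0), u i (sg i x) = sg i.+1 x) :
  preperfectoid p u (ext (s 0%N) I0) (ext (s 1%N) I1) /\
  forall J : forall i, R i -> Prop, pillars p t I0 I1 J ->
    pillars p u (ext (s 0%N) I0) (ext (s 1%N) I1) (fun i => ext (s i) (J i)) /\
    forall i (y : forall j, S (j + i)%N), tilt p u (ext (s 0%N) I0) y ->
      (stilt p u (ext (s 0%N) I0) (ext (s i) (J i)) y <->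
       exists n (a : 'I_n -> forall j, R (j + i)%N) (b : 'I_n -> forall j, S (j + i)%N),
         (forall k, stilt p t I0 (J i) (a k)) /\
         (forall k, tilt p u (ext (s 0%N) I0) (b k)) /\
         forall j, I0R u (ext (s 0%N) I0) (j + i)%N
                     (y j - \sum_(k < n) s (j + i)%N (a k j) * b k j)).
Proof.
have [_ [_ [[pi Hpi] [[g1 Hg1] _]]]] := Hpre.
have Spre := base_preperfectoid hp Hpre Het Hpo Hu1 Hu2 Hpi Hg1.
split=> // J HJ.
have SJ := base_pillars hp Hpre Het Hpo Hu1 Hu2 Hpi Hg1 HJ.
split=> // i y yT.
have Hpi' : same_set (ext (s 0%N) I0) (multiple (s 0%N pi)) by apply: ext_multiple.
have Hg1' : same_set (ext (s 1%N) I1) (multiple (s 1%N g1)) by apply: ext_multiple.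
(* The recursive choice of lifts starts from g1 at level 1; pi is put in front as level 0, and [fF]
   gives the compatibility there. *)
have next m (x : R m.+1) : {x' | Frel p t I0 m.+1 x' x} := cid (pre_surj Hpre x).
pose h : forall m, R m.+1 := nat_rect (fun m => R m.+1) g1 (fun m x => sval (next m x)).
pose f m : R m := match m return R m with 0 => pi | m'.+1 => h m' end.
have fS m : Frel p t I0 m.+1 (f m.+2) (f m.+1) := svalP (next m (h m)).
pose f' m := s m (f m).
have fS' m : Frel p u (ext (s 0%N) I0) m.+1 (f' m.+2) (f' m.+1).
  exact: base_Frel Hu1 _ _ _ (fS m).
have JI := pillar_ideal Hpi Hg1 HJ i.
have EI := ext_ideal (s i) (J i).
have KI' := ext_ideal (tw u i) (ext (s 0%N) I0).
have SI := idl_add_ideal EI KI'.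
split=> [[_ y0]|[n [a [b [aP [bP yE]]]]]].
  have y0' := pillar_gen_mod hp Spre Hpi' Hg1' (f := f') erefl erefl fS' SJ y0.
  (* Division by (f'_(i+j))_j, the image of a single element of the small tilt of I_i, leaves one
     summand. *)
  have [b [bT yb]] := tilt_divide hp Spre Hpi' Hg1' (f := f') erefl erefl fS' yT y0'.
  exists 1%N, (fun _ j => f (j + i)%N), (fun _ => b); split; last split=> // j.
    move=> _; split; last exact: (pillar_contains_gen hp Hpre Hpi Hg1 (f := f) erefl erefl fS HJ i).
    by move=> j; apply: (fF Hpre Hpi Hg1 (f := f) erefl erefl fS).
  by rewrite big_ord1; apply: yb.
(* As y is already in the tilt, only its component j = 0 has to be checked. *)
split=> //; apply/(ideal_congr SI (y := \sum_(k < n) s i (a k 0%N) * b k 0%N)).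
  by apply: idl_addr => //; apply: (yE 0%N).
apply: (ideal_sum SI) => k _; apply: (ideal_mulr SI).
have [_ [c [d [hc [hd ->]]]]] := aP k; exists (s i c), (s i d); rewrite rmorphD.
split; first exact: ext_gen.
by split=> //; apply/(base_I0R I0 Hu1); apply: ext_gen.
Qed.
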